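(* There is a number $s_1\in(1.03,1.04)$ such that $I(a,b)\le\lambda_s(a,b)\le A(a,b)$ for all $a,b>0$ whenever $s_1\le s\le 2$. These bounds are best possible: the inequality $I(a,b)\le \lambda_s(a,b)$ holds for all $a,b>0$ if and only if $s\ge s_1$, and the inequality $\lambda_s(a,b)\le A(a,b)$ holds for all $a,b>0$ if and only if $s\le 2$.
   Context: For $a,b>0$ with $a\neq b$ define $$\lambda_s(a,b)=\begin{cases}\dfrac{s-1}{s+1}\cdot\dfrac{a^{s+1}+b^{s+1}-2\left(\frac{a+b}{2}\right)^{s+1}}{a^s+b^s-2\left(\frac{a+b}{2}\right)^s}, & s\in\mathbb{R}\setminus\{-1,0,1\},\\[3mm] \dfrac{2\log\frac{a+b}{2}-\log a-\log b}{\frac{1}{2a}+\frac{1}{2b}-\frac{2}{a+b}}, & s=-1,\\[3mm] \dfrac{a\log a+b\log b-(a+b)\log\frac{a+b}{2}}{2\log\frac{a+b}{2}-\log a-\log b}, & s=0,\\[3mm] \dfrac{(b-a)^2}{4\left(a\log a+b\log b-(a+b)\log\frac{a+b}{2}\right)}, & s=1,\end{cases}$$ and $\lambda_s(a,a)=a$. The identric mean is $I(a,b)=\frac1e\,(b^b/a^a)^{1/(b-a)}$ for $a\ne b$, $I(a,a)=a$, and the arithmetic mean is $A(a,b)=(a+b)/2$. *)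

(* Defs.v *)
From Stdlib Require Import Reals Lra.
Open Scope R_scope.

Definition lambda (s a b : R) : R :=
  if Req_EM_T a b then a else
  let m := (a + b) / 2 in
  if Req_EM_T s (-1) then
    (2 * ln m - ln a - ln b) / (1 / (2 * a) + 1 / (2 * b) - 2 / (a + b))
  else if Req_EM_T s 0 then
    (a * ln a + b * ln b - (a + b) * ln m) / (2 * ln m - ln a - ln b)
  else if Req_EM_T s 1 then
    (b - a) ^ 2 / (4 * (a * ln a + b * ln b - (a + b) * ln m))
  else
    (s - 1) / (s + 1) *
    ((Rpower a (s + 1) + Rpower b (s + 1) - 2 * Rpower m (s + 1)) /
     (Rpower a s + Rpower b s - 2 * Rpower m s)).

Definition identric (a b : R) : R :=
  if Req_EM_T a b then a else
  (1 / exp 1) * Rpower (Rpower b b / Rpower a a) (1 / (b - a)).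

Definition amean (a b : R) : R := (a + b) / 2.

(* Main.v *)
Require Import Defs.
From Stdlib Require Import Reals Lra Lia ZArith List Bool Classical.
From Coquelicot Require Import Coquelicot.
Open Scope R_scope.

(** For [a <> b], [lambda s a b = Phi (s + 1) / Phi s], where [Phi s] is the
    midpoint convexity gap of a function with second derivative [x ^ (s - 2)].
    This makes [lambda] strictly increasing in [s], and [lambda 2] is the
    arithmetic mean, which settles the upper bound.

    By monotonicity and continuity in [s], the set of [s] for which the lower
    bound holds is a closed half-line, so it suffices to see that the bound
    fails for one [s > 1.03] (with [a : b = 1 : 1999]) and holds for one
    [s = 1 + d < 1.04]. For the latter write [a = 1 - h], [b = 1 + h],
    [x = h ^ 2]. Then [lambda = N / D] and [identric = exp (- Q)] with [N], [D],
    [Q] power series in [x]. The claim [D <= N exp Q] follows from a bound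
    [N >= 1 - alpha x] and from comparing all partial sums of the coefficients of
    [D] with those of a series below [exp Q] (Abel summation): numerically up to
    the index 40, and by induction with a telescoping majorant afterwards. *)

(** * Monotonicity from the sign of a derivative *)

Lemma is_derive_add (f g : R -> R) (x df dg : R) :
  is_derive f x df -> is_derive g x dg ->
  is_derive (fun y => f y + g y) x (df + dg).
Proof. exact (is_derive_plus f g x df dg). Qed.

Lemma is_derive_sub (f g : R -> R) (x df dg : R) :
  is_derive f x df -> is_derive g x dg ->
  is_derive (fun y => f y - g y) x (df - dg).
Proof. exact (is_derive_minus f g x df dg). Qed.

Lemma is_derive_neg (f : R -> R) (x df : R) :
  is_derive f x df -> is_derive (fun y => - f y) x (- df).
Proof. exact (is_derive_opp f x df). Qed.

Lemma le_of_derive (f f' : R -> R) (a b : R) :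
  a <= b ->
  (forall x, a <= x <= b -> is_derive f x (f' x)) ->
  (forall x, a < x < b -> 0 <= f' x) ->
  f a <= f b.
Proof.
  intros [Hab | ->] Hd Hp; [ | lra].
  destruct (MVT_cor2 f f' a b Hab) as [c [Hc Hcc]].
  { intros c Hc. apply is_derive_Reals, Hd, Hc. }
  specialize (Hp c Hcc).
  assert (0 <= f' c * (b - a)) by (apply Rmult_le_pos; lra).
  lra.
Qed.

Lemma lt_of_derive (f f' : R -> R) (a b : R) :
  a < b ->
  (forall x, a <= x <= b -> is_derive f x (f' x)) ->
  (forall x, a < x < b -> 0 < f' x) ->
  f a < f b.
Proof.
  intros Hab Hd Hp.
  destruct (MVT_cor2 f f' a b Hab) as [c [Hc Hcc]].
  { intros c Hc. apply is_derive_Reals, Hd, Hc. }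
  specialize (Hp c Hcc).
  assert (0 < f' c * (b - a)) by (apply Rmult_lt_0_compat; lra).
  lra.
Qed.

(** The sign of [f'] at [l] is left open; splitting the interval at [l] keeps the monotonicity
    strict. *)
Lemma lt_of_derive_except (f f' : R -> R) (a b l : R) :
  a < b ->
  (forall x, a <= x <= b -> is_derive f x (f' x)) ->
  (forall x, a < x < b -> x <> l -> 0 < f' x) ->
  f a < f b.
Proof.
  intros Hab Hd Hp.
  destruct (Rle_or_lt l a) as [Hl | Hl].
  { apply (lt_of_derive f f'); auto. intros x Hx. apply Hp; lra. }
  destruct (Rle_or_lt b l) as [Hl' | Hl'].
  { apply (lt_of_derive f f'); auto. intros x Hx. apply Hp; lra. }
  apply Rlt_trans with (f l).
  - apply (lt_of_derive f f'); auto; intros x Hx; [apply Hd | apply Hp]; lra.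
  - apply (lt_of_derive f f'); auto; intros x Hx; [apply Hd | apply Hp]; lra.
Qed.

(** * Midpoint convexity gaps and the monotonicity of [lambda] in [s] *)

Definition gap (f : R -> R) (a b : R) : R := f a + f b - 2 * f ((a + b) / 2).

(** The mean value theorem on both halves writes the gap as [(f' d - f' c) * (m - a)] with
    [c < m < d], and [f'] increases strictly. The exceptional point serves [lambda_lt], where the
    second derivative vanishes at one point. *)
Lemma gap_pos (f f' f'' : R -> R) (a b l : R) :
  a < b ->
  (forall x, a <= x <= b -> is_derive f x (f' x)) ->
  (forall x, a <= x <= b -> is_derive f' x (f'' x)) ->
  (forall x, a < x < b -> x <> l -> 0 < f'' x) ->
  0 < gap f a b.
Proof.
  intros Hab Hf Hf' Hp. unfold gap.
  set (m := (a + b) / 2).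
  assert (Hm : a < m < b) by (unfold m; lra).
  destruct (MVT_cor2 f f' a m) as [c [Hc Hcc]]; [lra | | ].
  { intros x Hx. apply is_derive_Reals, Hf. lra. }
  destruct (MVT_cor2 f f' m b) as [d [Hd Hdd]]; [lra | | ].
  { intros x Hx. apply is_derive_Reals, Hf. lra. }
  assert (Hcd : f' c < f' d).
  { apply (lt_of_derive_except f' f'' c d l); [lra | | ].
    - intros x Hx. apply Hf'. lra.
    - intros x Hx. apply Hp. lra. }
  replace (f a + f b - 2 * f m) with ((f' d - f' c) * (m - a)).
  - apply Rmult_lt_0_compat; lra.
  - replace (b - m) with (m - a) in Hd by (unfold m; field).
    lra.
Qed.

(** [curve s] is a primitive of order two of [x ^ (s - 2)]. *)
Definition curve (s x : R) : R :=
  if Req_EM_T s 0 then - ln x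
  else if Req_EM_T s 1 then x * ln x
  else Rpower x s / (s * (s - 1)).

Definition curve' (s x : R) : R :=
  if Req_EM_T s 1 then ln x + 1 else Rpower x (s - 1) / (s - 1).

Lemma is_derive_Rpower (p x : R) :
  0 < x -> is_derive (fun y => Rpower y p) x (p * Rpower x (p - 1)).
Proof.
  intros Hx. apply is_derive_Reals. now apply derivable_pt_lim_power.
Qed.

Lemma Rpower_minus_1 (x p : R) : 0 < x -> Rpower x (p - 1) = Rpower x p / x.
Proof.
  intros Hx. unfold Rminus, Rdiv.
  now rewrite Rpower_plus, Rpower_Ropp, Rpower_1.
Qed.

Lemma Rpower_plus_1 (x p : R) : 0 < x -> Rpower x (p + 1) = Rpower x p * x.
Proof. intros Hx. now rewrite Rpower_plus, Rpower_1. Qed.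

Lemma Rpower_pos (x p : R) : 0 < Rpower x p.
Proof. apply exp_pos. Qed.

Lemma is_derive_curve (s x : R) :
  0 < x -> is_derive (curve s) x (curve' s x).
Proof.
  intros Hx. unfold curve, curve'.
  destruct (Req_EM_T s 0) as [-> | H0].
  - destruct (Req_EM_T 0 1) as [H | _]; [lra | ].
    rewrite Rpower_minus_1, Rpower_O by assumption.
    auto_derive; [assumption | field; lra].
  - destruct (Req_EM_T s 1) as [_ | H1].
    + auto_derive; [assumption | field; lra].
    + replace (Rpower x (s - 1) / (s - 1))
        with (/ (s * (s - 1)) * (s * Rpower x (s - 1))) by (field; lra).
      apply (is_derive_ext (fun y => / (s * (s - 1)) * Rpower y s)).
      { intros t. apply Rmult_comm. }
      apply is_derive_scal. now apply is_derive_Rpower.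
Qed.

Lemma is_derive_curve' (s x : R) :
  0 < x -> is_derive (curve' s) x (Rpower x (s - 2)).
Proof.
  intros Hx. unfold curve'.
  destruct (Req_EM_T s 1) as [-> | H1].
  - replace (1 - 2) with (0 - 1) by ring.
    rewrite Rpower_minus_1, Rpower_O by assumption.
    auto_derive; [assumption | field; lra].
  - replace (Rpower x (s - 2))
      with (/ (s - 1) * ((s - 1) * Rpower x (s - 1 - 1)))
      by (replace (s - 1 - 1) with (s - 2) by ring; field; lra).
    apply (is_derive_ext (fun y => / (s - 1) * Rpower y (s - 1))).
    { intros t. apply Rmult_comm. }
    apply is_derive_scal. now apply is_derive_Rpower.
Qed.

Lemma Rpower_base_1 (p : R) : Rpower 1 p = 1.
Proof. unfold Rpower. now rewrite ln_1, Rmult_0_r, exp_0. Qed.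

Definition Phi (s a b : R) : R := gap (curve s) a b.

Lemma Phi_pos (s a b : R) : 0 < a -> a < b -> 0 < Phi s a b.
Proof.
  intros Ha Hab.
  apply (gap_pos _ (curve' s) (fun x => Rpower x (s - 2)) a b a Hab).
  - intros x Hx. apply is_derive_curve. lra.
  - intros x Hx. apply is_derive_curve'. lra.
  - intros x _ _. apply Rpower_pos.
Qed.

Lemma Phi_generic (s a b : R) : s <> 0 -> s <> 1 ->
  Phi s a b =
  (Rpower a s + Rpower b s - 2 * Rpower ((a + b) / 2) s) / (s * (s - 1)).
Proof.
  intros H0 H1. unfold Phi, gap, curve.
  destruct (Req_EM_T s 0); [easy | ].
  destruct (Req_EM_T s 1); [easy | ].
  field. lra.
Qed.

Lemma Phi_0 (a b : R) : Phi 0 a b = 2 * ln ((a + b) / 2) - ln a - ln b.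
Proof.
  unfold Phi, gap, curve. destruct (Req_EM_T 0 0); [ring | easy].
Qed.

Lemma Phi_1 (a b : R) :
  Phi 1 a b = a * ln a + b * ln b - (a + b) * ln ((a + b) / 2).
Proof.
  unfold Phi, gap, curve.
  destruct (Req_EM_T 1 0); [lra | ].
  destruct (Req_EM_T 1 1); [field | easy].
Qed.

Lemma Rpower_2 (x : R) : 0 < x -> Rpower x 2 = x ^ 2.
Proof. intros Hx. now rewrite <- (Rpower_pow 2). Qed.

Lemma Rpower_3 (x : R) : 0 < x -> Rpower x 3 = x ^ 3.
Proof. intros Hx. rewrite <- (Rpower_pow 3) by assumption. f_equal. simpl. ring. Qed.

Lemma Phi_2 (a b : R) : 0 < a -> 0 < b -> Phi 2 a b = (b - a) ^ 2 / 4.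
Proof.
  intros Ha Hb. rewrite Phi_generic by lra.
  rewrite !Rpower_2 by lra. field.
Qed.

Lemma Phi_3 (a b : R) :
  0 < a -> 0 < b -> Phi 3 a b = (a + b) / 2 * ((b - a) ^ 2 / 4).
Proof.
  intros Ha Hb. rewrite Phi_generic by lra.
  rewrite !Rpower_3 by lra. field.
Qed.

Lemma Phi_m1 (a b : R) : 0 < a -> 0 < b ->
  Phi (-1) a b = 1 / (2 * a) + 1 / (2 * b) - 2 / (a + b).
Proof.
  intros Ha Hb. rewrite Phi_generic by lra.
  rewrite !(Rpower_Ropp _ 1), !Rpower_1 by lra. field. lra.
Qed.

(** The special cases of [lambda] are those where [s] or [s + 1] is an exceptional index 0 or 1 of
    [curve]. Otherwise [(s - 1) / (s + 1)] is the quotient of the normalisations [s * (s - 1)] and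
    [(s + 1) * s]. *)
Lemma lambda_Phi (s a b : R) : 0 < a -> a < b ->
  lambda s a b = Phi (s + 1) a b / Phi s a b.
Proof.
  intros Ha Hab. unfold lambda.
  destruct (Req_EM_T a b) as [H | _]; [lra | ]. cbv zeta.
  assert (HP := Phi_pos s a b Ha Hab).
  destruct (Req_EM_T s (-1)) as [-> | Hm1].
  { replace (-1 + 1) with 0 by ring. now rewrite Phi_0, Phi_m1 by lra. }
  destruct (Req_EM_T s 0) as [-> | H0].
  { rewrite Rplus_0_l. now rewrite Phi_0, Phi_1. }
  destruct (Req_EM_T s 1) as [-> | H1].
  { replace (1 + 1) with 2 by ring. rewrite Phi_2, Phi_1 by lra.
    rewrite Phi_1 in HP. field. lra. }
  rewrite (Phi_generic s) in * by lra.
  rewrite (Phi_generic (s + 1)) by lra.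
  field. repeat split; try lra.
  intros H. rewrite H in HP. unfold Rdiv in HP. rewrite Rmult_0_l in HP. lra.
Qed.

Lemma lambda_sym (s a b : R) : lambda s a b = lambda s b a.
Proof.
  unfold lambda.
  destruct (Req_EM_T a b) as [-> | Hab].
  { now destruct (Req_EM_T b b). }
  destruct (Req_EM_T b a) as [H | _]; [congruence | ].
  cbv zeta. rewrite (Rplus_comm b a).
  destruct (Req_EM_T s (-1)); [f_equal; ring | ].
  destruct (Req_EM_T s 0); [f_equal; ring | ].
  destruct (Req_EM_T s 1); [f_equal; ring | ].
  f_equal. f_equal; ring.
Qed.

Lemma lambda_2 (a b : R) : 0 < a -> a < b -> lambda 2 a b = amean a b.
Proof.
  intros Ha Hab. rewrite lambda_Phi by assumption.
  replace (2 + 1) with 3 by ring.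
  rewrite Phi_3, Phi_2 by lra. unfold amean. field.
  lra.
Qed.

(** Since [l = lambda s a b] makes [Phi (s + 1) - l * Phi s] vanish, a positive gap of the test
    function leaves [Phi (t + 1) > l * Phi t]. *)
Lemma lambda_lt (s t a b : R) :
  0 < a -> a < b -> s < t -> lambda s a b < lambda t a b.
Proof.
  intros Ha Hab Hst.
  rewrite (lambda_Phi t) by assumption.
  assert (Hs := Phi_pos s a b Ha Hab).
  assert (Ht := Phi_pos t a b Ha Hab).
  set (l := lambda s a b).
  assert (Hl : Phi (s + 1) a b = l * Phi s a b).
  { unfold l. rewrite lambda_Phi by assumption. field. lra. }
  assert (Hl0 : 0 < l).
  { unfold l. rewrite lambda_Phi by assumption.
    apply Rdiv_lt_0_compat; apply Phi_pos; assumption. }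
  set (L := Rpower l (t - s)).
  (* The second derivative of the test function is
     [x^(s-2) (x - l) (x^(t-s) - l^(t-s))], positive for [x <> l]. *)
  assert (Hgap : 0 < gap (fun x => curve (t + 1) x - l * curve t x
            - L * (curve (s + 1) x - l * curve s x)) a b).
  { apply (gap_pos _
      (fun x => curve' (t + 1) x - l * curve' t x
            - L * (curve' (s + 1) x - l * curve' s x))
      (fun x => Rpower x (t + 1 - 2) - l * Rpower x (t - 2)
            - L * (Rpower x (s + 1 - 2) - l * Rpower x (s - 2))) a b l Hab).
    - intros x Hx.
      repeat first [apply is_derive_sub | apply is_derive_scal];
        apply is_derive_curve; lra.
    - intros x Hx.
      repeat first [apply is_derive_sub | apply is_derive_scal];
        apply is_derive_curve'; lra.
    - intros x Hx Hxl.
      replace (t + 1 - 2) with (s - 2 + (t - s) + 1) by ring.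
      replace (t - 2) with (s - 2 + (t - s)) by ring.
      replace (s + 1 - 2) with (s - 2 + 1) by ring.
      rewrite !Rpower_plus_1, Rpower_plus by lra.
      match goal with |- 0 < ?X =>
        replace X with (Rpower x (s - 2) * ((x - l) * (Rpower x (t - s) - L)))
          by ring end.
      apply Rmult_lt_0_compat; [apply Rpower_pos | ].
      destruct (Rdichotomy _ _ Hxl) as [H | H].
      + assert (Rpower x (t - s) < L) by (apply Rlt_Rpower_l; lra).
        rewrite <- Rmult_opp_opp. apply Rmult_lt_0_compat; lra.
      + assert (L < Rpower x (t - s)) by (apply Rlt_Rpower_l; lra).
        apply Rmult_lt_0_compat; lra. }
  replace (gap _ a b) with
    (Phi (t + 1) a b - l * Phi t a b - L * (Phi (s + 1) a b - l * Phi s a b))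
    in Hgap by (unfold Phi, gap; ring).
  apply (Rmult_lt_reg_r (Phi t a b)); [assumption | ].
  unfold Rdiv. rewrite Rmult_assoc, Rinv_l by lra.
  rewrite Hl in Hgap. lra.
Qed.

(** * Binomial sums as bounds for powers *)

Fixpoint binom (p : R) (n : nat) : R :=
  match n with
  | O => 1
  | S k => binom p k * (p - INR k) / INR (S k)
  end.

Definition binom_sum (p : R) (n : nat) (y : R) : R :=
  sum_f_R0 (fun k => binom p k * y ^ k) n.

(** The Taylor sum [B] of [(1 + y) ^ p] satisfies [(1 + y) * B' = p * B] up to a single monomial of
    degree [n]. *)
Lemma is_derive_binom_sum (p y : R) (n : nat) : 1 + y <> 0 ->
  is_derive (binom_sum p n) y
    ((p * binom_sum p n y - (p - INR n) * binom p n * y ^ n) / (1 + y)).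
Proof.
  intros Hy. induction n as [ | n IH].
  - unfold binom_sum. simpl.
    apply (is_derive_ext (fun _ => 1 * 1)); [reflexivity | ].
    match goal with |- is_derive _ _ ?v => replace v with 0 by (field; assumption) end.
    apply @is_derive_const.
  - assert (Hn : INR (S n) <> 0) by (apply not_0_INR; lia).
    apply (is_derive_ext
             (fun t => binom_sum p n t + binom p (S n) * t ^ S n)); [reflexivity | ].
    change (binom_sum p (S n) y) with (binom_sum p n y + binom p (S n) * y ^ S n).
    match goal with |- is_derive _ _ ?v => replace v with
      ((p * binom_sum p n y - (p - INR n) * binom p n * y ^ n) / (1 + y)
       + binom p (S n) * (INR (S n) * y ^ n)) end.
    + apply is_derive_add; [exact IH | ].
      apply is_derive_scal.
      evar_last; [apply is_derive_pow, is_derive_id | ].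
      change (@one R_AbsRing) with 1. simpl pred. cbn beta. ring.
    + change (binom p (S n)) with (binom p n * (p - INR n) / INR (S n)).
      rewrite S_INR in *. simpl pow. field. split; assumption.
Qed.

(** Division by [(1 + y) ^ p] is the integrating factor: the derivative has the sign of
    [(1 + y) * F' - p * F]. *)
Lemma is_derive_weighted (F : R -> R) (D p y : R) : 0 < 1 + y ->
  is_derive F y D ->
  is_derive (fun t => F t * Rpower (1 + t) (- p)) y
    (Rpower (1 + y) (- p - 1) * ((1 + y) * D - p * F y)).
Proof.
  intros Hy HF.
  evar_last.
  - apply (is_derive_mult F (fun t => Rpower (1 + t) (- p)));
      [exact HF | | exact Rmult_comm].
    apply (is_derive_comp (fun u => Rpower u (- p)) (fun t => 1 + t)).
    + now apply is_derive_Rpower.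
    + auto_derive; [exact I | reflexivity].
  - change scal with Rmult. change mult with Rmult. change plus with Rplus.
    cbn beta.
    replace (Rpower (1 + y) (- p)) with (Rpower (1 + y) (- p - 1) * (1 + y)).
    2: { rewrite <- Rpower_plus_1 by assumption. f_equal. ring. }
    change (@one R_AbsRing) with 1. ring.
Qed.

Lemma Rpower_inv_cancel (x p F : R) :
  0 < x -> F * Rpower x (- p) * Rpower x p = F.
Proof.
  intros Hx. rewrite Rmult_assoc, <- Rpower_plus.
  replace (- p + p) with 0 by ring. rewrite Rpower_O by assumption. ring.
Qed.

Lemma binom_sum_0 (p : R) (n : nat) : binom_sum p n 0 = 1.
Proof.
  unfold binom_sum. induction n as [ | n IH]; [simpl; ring | ].
  rewrite tech5, IH. simpl. ring.
Qed.

Lemma binom_S (p : R) (n : nat) :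
  INR (S n) * binom p (S n) = binom p n * (p - INR n).
Proof.
  change (binom p (S n)) with (binom p n * (p - INR n) / INR (S n)).
  field. apply not_0_INR. lia.
Qed.

(** The quotient of the Taylor sum by [(1 + y) ^ p] is 1 at 0, and the sign of its derivative is
    opposite to that of the first omitted coefficient. *)
Lemma binom_sum_ge (p y : R) (n : nat) : 0 <= y -> binom p (S n) <= 0 ->
  Rpower (1 + y) p <= binom_sum p n y.
Proof.
  intros Hy Hb.
  rewrite <- (Rpower_inv_cancel (1 + y) p (binom_sum p n y)) by lra.
  rewrite <- (Rmult_1_l (Rpower (1 + y) p)) at 1.
  apply Rmult_le_compat_r; [apply Rlt_le, Rpower_pos | ].
  apply Rle_trans with (binom_sum p n 0 * Rpower (1 + 0) (- p)).
  { right. rewrite binom_sum_0, Rplus_0_r, Rpower_base_1. ring. }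
  eapply (le_of_derive (fun t => binom_sum p n t * Rpower (1 + t) (- p)) _ 0 y Hy).
  - intros x Hx. apply is_derive_weighted; [lra | ].
    apply is_derive_binom_sum. lra.
  - intros x Hx. apply Rmult_le_pos; [apply Rlt_le, Rpower_pos | ].
    match goal with |- 0 <= ?X =>
      replace X with (- binom p (S n) * (INR (S n) * x ^ n)) end.
    + apply Rmult_le_pos; [lra | ].
      apply Rmult_le_pos; [apply pos_INR | apply pow_le; lra].
    + replace (- binom p (S n) * (INR (S n) * x ^ n))
        with (- (INR (S n) * binom p (S n)) * x ^ n) by ring.
      rewrite binom_S. field. lra.
Qed.

Lemma binom_sum_le (p y : R) (n : nat) : 0 <= y -> 0 <= binom p (S n) ->
  binom_sum p n y <= Rpower (1 + y) p.
Proof.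
  intros Hy Hb.
  rewrite <- (Rpower_inv_cancel (1 + y) p (binom_sum p n y)) by lra.
  rewrite <- (Rmult_1_l (Rpower (1 + y) p)) at 2.
  apply Rmult_le_compat_r; [apply Rlt_le, Rpower_pos | ].
  apply Ropp_le_cancel.
  apply Rle_trans with (- (binom_sum p n 0 * Rpower (1 + 0) (- p))).
  { right. rewrite binom_sum_0, Rplus_0_r, Rpower_base_1. ring. }
  eapply (le_of_derive (fun t => - (binom_sum p n t * Rpower (1 + t) (- p)))  _ 0 y Hy).
  - intros x Hx. apply is_derive_neg. apply is_derive_weighted; [lra | ].
    apply is_derive_binom_sum. lra.
  - intros x Hx. cbv beta. rewrite Ropp_mult_distr_r.
    apply Rmult_le_pos; [apply Rlt_le, Rpower_pos | ].
    match goal with |- 0 <= ?X =>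
      replace X with (binom p (S n) * (INR (S n) * x ^ n)) end.
    + apply Rmult_le_pos; [lra | ].
      apply Rmult_le_pos; [apply pos_INR | apply pow_le; lra].
    + replace (binom p (S n) * (INR (S n) * x ^ n))
        with ((INR (S n) * binom p (S n)) * x ^ n) by ring.
      rewrite binom_S. field. lra.
Qed.

(** The coefficient for which [binom_sum p n (- h) + c * h ^ (n + 1)] has the
    same value at [h = 1] as [(1 - h) ^ p]. *)
Definition tail_coeff (p : R) (n : nat) : R :=
  - (-1) ^ n * (p - INR n) * binom p n / p.

(** With this coefficient the leftover monomials of degrees [n] and [n + 1] combine to a multiple of
    [h ^ n * (1 - h)], so the derivative keeps one sign up to [h = 1]. *)
Lemma is_derive_tail (p h : R) (n : nat) : p <> 0 -> h < 1 ->
  is_derive (fun t => (binom_sum p n (- t) + tail_coeff p n * t ^ S n)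
                      * Rpower (1 - t) (- p)) h
    (Rpower (1 - h) (- p - 1)
     * (tail_coeff p n * (INR (S n) - p) * h ^ n * (1 - h))).
Proof.
  intros Hp Hh.
  set (F := fun y => binom_sum p n y + tail_coeff p n * (- y) ^ S n).
  set (D := (p * binom_sum p n (- h) - (p - INR n) * binom p n * (- h) ^ n) / (1 + - h)
            - tail_coeff p n * (INR (S n) * h ^ n)).
  assert (HF : is_derive F (- h) D).
  { apply is_derive_add; [apply is_derive_binom_sum; lra | ].
    rewrite Ropp_mult_distr_r. apply is_derive_scal.
    auto_derive; [exact I | ]. simpl pred. rewrite Ropp_involutive.
    change (match n with 0%nat => 1 | S _ => INR n + 1 end) with (INR (S n)).
    ring. }
  apply (is_derive_weighted _ _ p) in HF; [ | lra].
  apply (is_derive_ext (fun t => (fun u => F u * Rpower (1 + u) (- p)) (- t))).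
  { intros t. unfold F. rewrite Ropp_involutive. reflexivity. }
  evar_last.
  - apply (is_derive_comp (fun u => F u * Rpower (1 + u) (- p)) (fun t => - t)).
    + exact HF.
    + auto_derive; [exact I | reflexivity].
  - change scal with Rmult. cbn beta.
    change (1 - h) with (1 + - h). unfold F, D.
    rewrite Ropp_involutive.
    assert (E : (p - INR n) * binom p n * (- h) ^ n = - p * tail_coeff p n * h ^ n).
    { unfold tail_coeff. replace (- h) with (-1 * h) by ring.
      rewrite Rpow_mult_distr. field. assumption. }
    rewrite E. rewrite S_INR. simpl pow. field. lra.
Qed.

Lemma binom_tail_ge (p h : R) (n : nat) :
  0 < p < INR (S n) -> 0 <= h < 1 -> 0 <= tail_coeff p n ->
  Rpower (1 - h) p <= binom_sum p n (- h) + tail_coeff p n * h ^ S n.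
Proof.
  intros Hp Hh Hc.
  rewrite <- (Rpower_inv_cancel (1 - h) p (binom_sum p n (- h) + _)) by lra.
  rewrite <- (Rmult_1_l (Rpower (1 - h) p)) at 1.
  apply Rmult_le_compat_r; [apply Rlt_le, Rpower_pos | ].
  apply Rle_trans with
    ((binom_sum p n (- 0) + tail_coeff p n * 0 ^ S n) * Rpower (1 - 0) (- p)).
  { right. rewrite Ropp_0, binom_sum_0, Rminus_0_r, Rpower_base_1. simpl pow. ring. }
  eapply (le_of_derive (fun t => (binom_sum p n (- t) + tail_coeff p n * t ^ S n)
                      * Rpower (1 - t) (- p)) _ 0 h (proj1 Hh)).
  - intros x Hx. apply is_derive_tail; lra.
  - intros x Hx. apply Rmult_le_pos; [apply Rlt_le, Rpower_pos | ].
    assert (0 <= x ^ n) by (apply pow_le; lra).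
    apply Rmult_le_pos; [apply Rmult_le_pos; [apply Rmult_le_pos | ] | ]; lra.
Qed.

Lemma binom_tail_le (p h : R) (n : nat) :
  0 < p < INR (S n) -> 0 <= h < 1 -> tail_coeff p n <= 0 ->
  binom_sum p n (- h) + tail_coeff p n * h ^ S n <= Rpower (1 - h) p.
Proof.
  intros Hp Hh Hc.
  rewrite <- (Rpower_inv_cancel (1 - h) p (binom_sum p n (- h) + _)) by lra.
  rewrite <- (Rmult_1_l (Rpower (1 - h) p)) at 2.
  apply Rmult_le_compat_r; [apply Rlt_le, Rpower_pos | ].
  apply Ropp_le_cancel.
  apply Rle_trans with (-
    ((binom_sum p n (- 0) + tail_coeff p n * 0 ^ S n) * Rpower (1 - 0) (- p))).
  { right. rewrite Ropp_0, binom_sum_0, Rminus_0_r, Rpower_base_1. simpl pow. ring. }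
  eapply (le_of_derive (fun t => - ((binom_sum p n (- t) + tail_coeff p n * t ^ S n)
                      * Rpower (1 - t) (- p))) _ 0 h (proj1 Hh)).
  - intros x Hx. apply is_derive_neg. apply is_derive_tail; lra.
  - intros x Hx. cbv beta. rewrite Ropp_mult_distr_r.
    apply Rmult_le_pos; [apply Rlt_le, Rpower_pos | ].
    replace (- (tail_coeff p n * (INR (S n) - p) * x ^ n * (1 - x)))
      with (- tail_coeff p n * (INR (S n) - p) * x ^ n * (1 - x)) by ring.
    assert (0 <= x ^ n) by (apply pow_le; lra).
    apply Rmult_le_pos; [apply Rmult_le_pos; [apply Rmult_le_pos | ] | ]; lra.
Qed.

(** * Truncated series for the numerator and the denominator of [lambda] *)

(** Up to the factor [p * (p - 1)] this is [Phi p] at [1 - h] and [1 + h], whose midpoint is 1. *)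
Definition even_gap (p h : R) : R := Rpower (1 + h) p + Rpower (1 - h) p - 2.

(** The coefficients of [D] in the variable [x = h ^ 2], see [binom_dcoef]. *)
Fixpoint dcoef (d : R) (k : nat) : R :=
  match k with
  | O => 1
  | S j => dcoef d j * ((2 * INR j + 1 - d) * (2 * INR j + 2 - d))
           / ((2 * INR j + 3) * (2 * INR j + 4))
  end.

Lemma binom_dcoef (d : R) (k : nat) :
  binom (1 + d) (2 * k + 2) = (1 + d) * d / 2 * dcoef d k.
Proof.
  induction k as [ | k IH].
  - simpl. field.
  - replace (2 * S k + 2)%nat with (S (S (2 * k + 2))) by lia.
    cbn [binom]. rewrite IH. cbn [dcoef].
    rewrite !S_INR, plus_INR, mult_INR. simpl (INR 2).
    assert (H := pos_INR k). field. lra.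
Qed.

Lemma dcoef_pos (d : R) (k : nat) : d < 1 -> 0 < dcoef d k.
Proof.
  intros Hd. induction k as [ | k IH]; [simpl; lra | ].
  cbn [dcoef]. assert (H := pos_INR k).
  apply Rdiv_lt_0_compat; repeat apply Rmult_lt_0_compat; lra.
Qed.

(** Keeps the tail coefficient in [even_gap_le] bounded uniformly in the truncation index. *)
Lemma dcoef_le (d : R) (k : nat) :
  0 <= d < 1 -> (INR k + 1) * dcoef d k <= 1.
Proof.
  intros Hd. induction k as [ | k IH]; [simpl; lra | ].
  cbn [dcoef]. rewrite S_INR.
  assert (H := pos_INR k). assert (Hp := dcoef_pos d k (proj2 Hd)).
  set (n := INR k) in *. set (c := dcoef d k) in *.
  apply Rle_trans with ((n + 1) * c); [ | exact IH].
  replace ((n + 1 + 1) * (c * ((2 * n + 1 - d) * (2 * n + 2 - d)) / ((2 * n + 3) * (2 * n + 4))))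
    with (c * ((2 * n + 1 - d) * (2 * n + 2 - d)) / (2 * (2 * n + 3))) by (field; lra).
  apply Rle_div_l; [lra | ].
  replace ((n + 1) * c * (2 * (2 * n + 3))) with (c * ((2 * n + 2) * (2 * n + 3))) by ring.
  apply Rmult_le_compat_l; [lra | nra].
Qed.

Lemma binom_sum_even (p h : R) (n : nat) :
  binom_sum p (2 * n) h + binom_sum p (2 * n) (- h)
  = 2 * sum_f_R0 (fun k => binom p (2 * k) * (h ^ 2) ^ k) n.
Proof.
  induction n as [ | n IH]; [unfold binom_sum; simpl; ring | ].
  replace (2 * S n)%nat with (S (S (2 * n))) by lia.
  rewrite tech5, Rmult_plus_distr_l, <- IH.
  unfold binom_sum. rewrite !tech5.
  replace (2 * S n)%nat with (S (S (2 * n))) by lia.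
  rewrite <- pow_mult. replace (2 * S n)%nat with (S (S (2 * n))) by lia.
  assert (E : (- h) ^ (2 * n) = h ^ (2 * n)).
  { rewrite !pow_mult. f_equal. ring. }
  set (m := (2 * n)%nat) in *. cbn [pow]. rewrite E. ring.
Qed.

(** Adding the bounds at [h] and [- h] cancels the odd powers and leaves the series of [dcoef], with
    a remainder that tends to 0 as [n] grows. *)
Lemma even_gap_le (d h : R) (n : nat) : 0 < d < 1 -> 0 < h < 1 ->
  even_gap (1 + d) h <=
  (1 + d) * d * h ^ 2
  * (sum_f_R0 (fun k => dcoef d k * (h ^ 2) ^ k) n + h ^ (2 * n + 1)).
Proof.
  (* An even degree makes the next coefficient nonpositive and the tail coefficient nonnegative, as
     the two bounds require. *)
  intros Hd Hh. set (m := (2 * S n)%nat).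
  assert (Hn := pos_INR n).
  assert (Em : INR m = 2 * INR n + 2).
  { unfold m. rewrite mult_INR, (S_INR n). simpl (INR 2). ring. }
  assert (Eb : binom (1 + d) m = (1 + d) * d / 2 * dcoef d n).
  { rewrite <- binom_dcoef. f_equal. unfold m. lia. }
  assert (Hdn := dcoef_pos d n (proj2 Hd)).
  assert (Hdl := dcoef_le d n).
  assert (Hpb : 0 < (1 + d) * d / 2 * dcoef d n) by (apply Rmult_lt_0_compat; nra).
  assert (Hc : tail_coeff (1 + d) m = (2 * INR n + 1 - d) * (d / 2) * dcoef d n).
  { unfold tail_coeff. rewrite Em, Eb. unfold m. rewrite pow_1_even. field. lra. }
  assert (Hplus : Rpower (1 + h) (1 + d) <= binom_sum (1 + d) m h).
  { apply binom_sum_ge; [lra | ].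
    apply (Rmult_le_reg_l (INR (S m))); [apply lt_0_INR; lia | ].
    rewrite binom_S, Rmult_0_r, Em, Eb. nra. }
  assert (Hminus : Rpower (1 - h) (1 + d)
    <= binom_sum (1 + d) m (- h) + tail_coeff (1 + d) m * h ^ S m).
  { apply binom_tail_ge; [rewrite S_INR | | rewrite Hc]; [lra | lra | ].
    apply Rmult_le_pos; [apply Rmult_le_pos | ]; lra. }
  unfold even_gap.
  assert (E := binom_sum_even (1 + d) h (S n)). fold m in E.
  rewrite decomp_sum in E by lia. simpl pred in E.
  assert (Esum : 2 * sum_f_R0 (fun k => binom (1 + d) (2 * S k) * (h ^ 2) ^ S k) n
    = (1 + d) * d * h ^ 2 * sum_f_R0 (fun k => dcoef d k * (h ^ 2) ^ k) n).
  { rewrite !scal_sum. apply sum_eq. intros k _.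
    replace (2 * S k)%nat with (2 * k + 2)%nat by lia.
    rewrite binom_dcoef. cbn [pow]. field. }
  assert (Htail : tail_coeff (1 + d) m * h ^ S m <= (1 + d) * d * h ^ 2 * h ^ (2 * n + 1)).
  { replace (h ^ S m) with (h ^ 2 * h ^ (2 * n + 1)).
    2: { rewrite <- pow_add. f_equal. unfold m. lia. }
    rewrite Hc, <- !Rmult_assoc.
    repeat (apply Rmult_le_compat_r; [apply pow_le; lra | ]).
    assert ((INR n + 1) * dcoef d n <= 1) by (apply Hdl; lra).
    nra. }
  replace (binom (1 + d) (2 * 0) * (h ^ 2) ^ 0) with 1 in E by (simpl; ring).
  rewrite Rmult_plus_distr_l in E. rewrite Esum in E. lra.
Qed.

(** Degree 6 suffices here. The constant is [7 / 60 = 2 / 24 + 2 * 6 / 720 + 6 * 2 / 720], from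
    degree 4, degree 6 and the tail of degree 7, using [r <= 6], [(4 - d) / (2 + d) <= 2] and
    [h ^ 7 <= h ^ 6 <= h ^ 4]. *)
Lemma even_gap_ge (d h : R) : 0 < d < 1 -> 0 < h < 1 ->
  (2 + d) * (1 + d) * h ^ 2 * (1 - 7 / 60 * d * (1 - d) * h ^ 2)
  <= even_gap (2 + d) h.
Proof.
  intros Hd Hh.
  set (P := (2 + d) * (1 + d)). set (r := (2 - d) * (3 - d)).
  assert (HP : 0 < P) by (unfold P; nra).
  assert (Hr : 0 < r <= 6) by (unfold r; nra).
  assert (H4 : binom (2 + d) 4 = - (P * d * (1 - d)) / 24)
    by (unfold P; simpl; field).
  assert (H6 : binom (2 + d) 6 = - (P * d * (1 - d) * r) / 720)
    by (unfold P, r; simpl; field).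
  assert (H7 : 0 <= binom (2 + d) 7).
  { change (binom (2 + d) 7) with (binom (2 + d) 6 * (2 + d - INR 6) / INR 7).
    rewrite H6. simpl INR.
    replace (- (P * d * (1 - d) * r) / 720 * (2 + d - (1 + 1 + 1 + 1 + 1 + 1)) / (1 + 1 + 1 + 1 + 1 + 1 + 1))
      with (P * (d * (1 - d) * r) * (4 - d) / 5040) by field.
    assert (0 < d * (1 - d) * r)
      by (apply Rmult_lt_0_compat; [apply Rmult_lt_0_compat | ]; lra).
    apply Rdiv_le_0_compat; [ | lra].
    apply Rmult_le_pos; [apply Rmult_le_pos | ]; lra. }
  assert (Ht : tail_coeff (2 + d) 6 = - (P * d * (1 - d) * r) / 720 * ((4 - d) / (2 + d))).
  { unfold tail_coeff. rewrite H6. simpl. field. lra. }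
  assert (Hq : 0 < (4 - d) / (2 + d) <= 2).
  { split; [apply Rdiv_lt_0_compat; lra | apply Rle_div_l; lra]. }
  assert (Hs : 0 <= P * d * (1 - d)).
  { apply Rmult_le_pos; [apply Rmult_le_pos | ]; lra. }
  assert (Hplus := binom_sum_le (2 + d) h 6 ltac:(lra) H7).
  assert (Hminus : binom_sum (2 + d) 6 (- h) + tail_coeff (2 + d) 6 * h ^ 7
    <= Rpower (1 - h) (2 + d)).
  { apply binom_tail_le; [simpl; lra | lra | rewrite Ht].
    assert (0 <= P * d * (1 - d) * r) by (apply Rmult_le_pos; lra). nra. }
  unfold even_gap.
  assert (E := binom_sum_even (2 + d) h 3).
  assert (E3 : sum_f_R0 (fun k => binom (2 + d) (2 * k) * (h ^ 2) ^ k) 3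
    = 1 + P / 2 * h ^ 2 + binom (2 + d) 4 * h ^ 4 + binom (2 + d) 6 * h ^ 6).
  { change (sum_f_R0 (fun k => binom (2 + d) (2 * k) * (h ^ 2) ^ k) 3)
      with (binom (2 + d) 0 * (h ^ 2) ^ 0 + binom (2 + d) 2 * (h ^ 2) ^ 1
            + binom (2 + d) 4 * (h ^ 2) ^ 2 + binom (2 + d) 6 * (h ^ 2) ^ 3).
    replace (binom (2 + d) 2) with (P / 2) by (unfold P; simpl; field).
    simpl (binom (2 + d) 0). ring. }
  change (2 * 3)%nat with 6%nat in E.
  rewrite E3, H4, H6 in E. rewrite Ht in Hminus.
  set (c := P * d * (1 - d)) in *.
  assert (Hh4 : 0 < h ^ 4) by (apply pow_lt; lra).
  assert (Hle : forall k, 0 <= h ^ (4 + k) <= h ^ 4).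
  { intros k. rewrite pow_add.
    assert (0 < h ^ k) by (apply pow_lt; lra).
    assert (h ^ k <= 1) by (rewrite <- (pow1 k); apply pow_incr; lra).
    nra. }
  assert (B6 : c * (r * h ^ 6) <= c * (6 * h ^ 4)).
  { apply Rmult_le_compat_l; [assumption | ].
    apply Rmult_le_compat; [lra | apply (Hle 2%nat) | lra | apply (Hle 2%nat)]. }
  assert (B7 : c * (r * ((4 - d) / (2 + d)) * h ^ 7) <= c * (6 * 2 * h ^ 4)).
  { apply Rmult_le_compat_l; [assumption | ].
    assert (0 <= r * ((4 - d) / (2 + d)) <= 6 * 2).
    { split; [apply Rmult_le_pos | apply Rmult_le_compat]; lra. }
    apply Rmult_le_compat; [lra | apply (Hle 3%nat) | lra | apply (Hle 3%nat)]. }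
  replace (P * h ^ 2 * (1 - 7 / 60 * d * (1 - d) * h ^ 2))
    with (P * h ^ 2 - 7 / 60 * (c * h ^ 4)) by (unfold c; ring).
  lra.
Qed.

(** * Lower bounds for the exponential of a polynomial *)

Lemma abel_nonneg (a : nat -> R) (x : R) (n : nat) : 0 <= x <= 1 ->
  (forall k, (k <= n)%nat -> 0 <= sum_f_R0 a k) ->
  0 <= sum_f_R0 (fun k => a k * x ^ k) n.
Proof.
  intros Hx Ha.
  (* The induction needs this stronger form, which keeps the last partial sum with the smallest
     weight [x ^ n]. *)
  enough (H : x ^ n * sum_f_R0 a n <= sum_f_R0 (fun k => a k * x ^ k) n).
  { apply Rle_trans with (2 := H). apply Rmult_le_pos; [apply pow_le; lra | ].
    apply Ha. lia. }
  induction n as [ | n IH]; [simpl; lra | ].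
  rewrite !tech5.
  assert (H : x ^ n * sum_f_R0 a n <= sum_f_R0 (fun k => a k * x ^ k) n).
  { apply IH. intros k Hk. apply Ha. lia. }
  assert (H0 : 0 <= sum_f_R0 a n) by (apply Ha; lia).
  assert (Hp : 0 <= x ^ n) by (apply pow_le; lra).
  assert (x * (x ^ n * sum_f_R0 a n) <= 1 * (x ^ n * sum_f_R0 a n)).
  { apply Rmult_le_compat_r; [apply Rmult_le_pos; assumption | lra]. }
  cbn [pow]. lra.
Qed.

Lemma is_derive_sum_f (f g : nat -> R -> R) (x : R) (n : nat) :
  (forall k, is_derive (f k) x (g k x)) ->
  is_derive (fun t => sum_f_R0 (fun k => f k t) n) x
    (sum_f_R0 (fun k => g k x) n).
Proof.
  intros H. induction n as [ | n IH]; [apply H | ].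
  simpl. apply is_derive_add; [exact IH | apply H].
Qed.

Lemma is_derive_monomial (c x : R) (n : nat) :
  is_derive (fun t => c * t ^ S n) x (c * (INR (S n) * x ^ n)).
Proof.
  apply is_derive_scal. apply is_derive_Reals. apply (derivable_pt_lim_pow x (S n)).
Qed.

Lemma sum_f_nonneg (f : nat -> R) (n : nat) :
  (forall k, 0 <= f k) -> 0 <= sum_f_R0 f n.
Proof. intros H. now apply cond_pos_sum. Qed.

(** The left-hand side is the triangle [i + j <= n] of the full product; the remaining terms are
    nonnegative. *)
Lemma cauchy_product_le (a b : nat -> R) (n : nat) :
  (forall k, 0 <= a k) -> (forall k, 0 <= b k) ->
  sum_f_R0 (fun k => sum_f_R0 (fun i => a i * b (k - i)%nat) k) n
  <= sum_f_R0 a n * sum_f_R0 b n.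
Proof.
  intros Ha Hb. destruct n as [ | n]; [simpl; lra | ].
  rewrite (cauchy_finite a b (S n)) by lia.
  match goal with |- ?A <= ?A + ?B => enough (0 <= B) by lra end.
  apply sum_f_nonneg. intros k. apply sum_f_nonneg. intros l.
  now apply Rmult_le_pos.
Qed.

(** Comparing derivatives: the hypothesis on [e] says [F' <= q' F]
    coefficientwise up to degree [n], where [F] is the left-hand side. *)
Lemma exp_sum_ge (q e : nat -> R) (x : R) (n : nat) : 0 <= x ->
  (forall k, 0 <= q k) -> (forall k, 0 <= e k) -> e 0%nat <= 1 ->
  (forall k, INR (S k) * e (S k)
     <= sum_f_R0 (fun i => e i * (INR (S (k - i)) * q (k - i)%nat)) k) ->
  sum_f_R0 (fun k => e k * x ^ k) (S n)
  <= exp (sum_f_R0 (fun k => q k * x ^ S k) n).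
Proof.
  intros Hx Hq He H0 Hrec.
  set (F := fun t => sum_f_R0 (fun k => e k * t ^ k) (S n)).
  set (Q := fun t => sum_f_R0 (fun k => q k * t ^ S k) n).
  set (F' := fun t => sum_f_R0 (fun k => e (S k) * (INR (S k) * t ^ k)) n).
  set (Q' := fun t => sum_f_R0 (fun k => q k * (INR (S k) * t ^ k)) n).
  assert (HF : forall t, is_derive F t (F' t)).
  { intros t.
    apply (is_derive_ext
      (fun t => e 0%nat + sum_f_R0 (fun k => e (S k) * t ^ S k) n)).
    { intros u. unfold F. rewrite (decomp_sum _ (S n)) by lia. simpl. ring. }
    rewrite <- (Rplus_0_l (F' t)).
    apply is_derive_add; [apply @is_derive_const | ].
    apply (is_derive_sum_f (fun k t => e (S k) * t ^ S k)
             (fun k t => e (S k) * (INR (S k) * t ^ k))).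
    intros k. apply is_derive_monomial. }
  assert (HQ : forall t, is_derive Q t (Q' t)).
  { intros t. apply (is_derive_sum_f (fun k t => q k * t ^ S k)
             (fun k t => q k * (INR (S k) * t ^ k))).
    intros k. apply is_derive_monomial. }
  assert (Hle : forall t, 0 <= t -> F' t <= F t * Q' t).
  { intros t Ht. assert (Hp : forall k, 0 <= t ^ k) by (intros; now apply pow_le).
    (* Dropping the top term of [F] gives both factors degree [n], as the Cauchy product
       requires. *)
    apply Rle_trans with (sum_f_R0 (fun k => e k * t ^ k) n * Q' t).
    - eapply Rle_trans; [ | apply cauchy_product_le].
      + apply sum_Rle. intros k _.
        replace (e (S k) * (INR (S k) * t ^ k)) with (INR (S k) * e (S k) * t ^ k) by ring.
        eapply Rle_trans; [apply Rmult_le_compat_r; [apply Hp | apply Hrec] | ].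
        right. rewrite Rmult_comm, scal_sum. apply sum_eq. intros i Hi.
        replace (t ^ k) with (t ^ i * t ^ (k - i)).
        * ring.
        * rewrite <- pow_add. f_equal. lia.
      + intros k. now apply Rmult_le_pos.
      + intros k. apply Rmult_le_pos; [apply Hq | ].
        apply Rmult_le_pos; [apply pos_INR | apply Hp].
    - apply Rmult_le_compat_r.
      + apply sum_f_nonneg. intros k. apply Rmult_le_pos; [apply Hq | ].
        apply Rmult_le_pos; [apply pos_INR | apply Hp].
      + unfold F. rewrite tech5.
        assert (0 <= e (S n) * t ^ S n) by now apply Rmult_le_pos.
        lra. }
  (* [F * exp (- Q)] is nonincreasing and starts from [e 0 <= 1]. *)
  assert (Hmon : - (F 0 * exp (- Q 0)) <= - (F x * exp (- Q x))).
  { apply (le_of_derive (fun t => - (F t * exp (- Q t)))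
      (fun t => - (F' t * exp (- Q t) + F t * (- Q' t * exp (- Q t)))) 0 x Hx).
    - intros t _. apply is_derive_neg.
      apply (is_derive_mult F (fun t => exp (- Q t)));
        [apply HF | | exact Rmult_comm].
      apply (is_derive_comp exp (fun t => - Q t)).
      + apply is_derive_Reals. apply derivable_pt_lim_exp.
      + apply is_derive_neg. apply HQ.
    - intros t Ht. specialize (Hle t ltac:(lra)).
      assert (Hpos := exp_pos (- Q t)). nra. }
  assert (F0 : F 0 = e 0%nat).
  { unfold F. rewrite decomp_sum by lia. simpl pred.
    rewrite (sum_eq _ (fun _ => 0)).
    - rewrite sum_cte. simpl. ring.
    - intros i _. simpl. ring. }
  assert (Q0 : Q 0 = 0).
  { unfold Q. rewrite (sum_eq _ (fun _ => 0)).
    - rewrite sum_cte. ring.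
    - intros i _. simpl. ring. }
  rewrite F0, Q0, Ropp_0, exp_0 in Hmon.
  fold (F x) (Q x).
  replace (F x) with (F x * exp (- Q x) * exp (Q x)).
  - rewrite <- (Rmult_1_l (exp (Q x))) at 2.
    apply Rmult_le_compat_r; [apply Rlt_le, exp_pos | lra].
  - rewrite Rmult_assoc, <- exp_plus, Rplus_opp_l, exp_0. ring.
Qed.

(** * Series for the logarithm and for the exponent of the identric mean *)

Lemma geometric_sum_le (x : R) (n : nat) : 0 <= x < 1 ->
  (1 - x) * sum_f_R0 (fun k => x ^ k) n <= 1.
Proof.
  intros Hx. rewrite tech3 by lra.
  replace ((1 - x) * ((1 - x ^ S n) / (1 - x))) with (1 - x ^ S n) by (field; lra).
  assert (0 <= x ^ S n) by (apply pow_le; lra). lra.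
Qed.

Lemma ln_sum_le (x : R) (n : nat) : 0 <= x < 1 ->
  sum_f_R0 (fun k => / INR (S k) * x ^ S k) n <= - ln (1 - x).
Proof.
  intros Hx.
  enough (H : - ln (1 - 0) - sum_f_R0 (fun k => / INR (S k) * 0 ^ S k) n
    <= - ln (1 - x) - sum_f_R0 (fun k => / INR (S k) * x ^ S k) n).
  { rewrite Rminus_0_r, ln_1, (sum_eq _ (fun _ => 0)), sum_cte in H; [lra | ].
    intros i _. simpl. ring. }
  eapply (le_of_derive (fun t => - ln (1 - t) - sum_f_R0 (fun k => / INR (S k) * t ^ S k) n)
    (fun t => / (1 - t) - sum_f_R0 (fun k => / INR (S k) * (INR (S k) * t ^ k)) n)); [lra | | ].
  - intros t Ht. apply is_derive_sub.
    + auto_derive; [lra | field; lra].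
    + apply (is_derive_sum_f (fun k t => / INR (S k) * t ^ S k)
        (fun k t => / INR (S k) * (INR (S k) * t ^ k))).
      intros k. apply is_derive_monomial.
  - intros t Ht.
    rewrite (sum_eq _ (fun k => t ^ k)).
    2: { intros i _. field. apply not_0_INR. lia. }
    assert (H := geometric_sum_le t n ltac:(lra)).
    enough (sum_f_R0 (fun k => t ^ k) n <= / (1 - t)) by lra.
    apply (Rmult_le_reg_l (1 - t)); [lra | ]. rewrite Rinv_r by lra. exact H.
Qed.

(** The coefficient of [x ^ (k + 1)] in [Q = 1 - entropy h / (2 * h)], where [x = h ^ 2] and
    [exp (- Q)] is the identric mean of [1 - h] and [1 + h]. *)
Definition log_coeff (k : nat) : R := / ((2 * INR k + 2) * (2 * INR k + 3)).

Definition entropy (h : R) : R := (1 + h) * ln (1 + h) - (1 - h) * ln (1 - h).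

(** The derivative of [2 * t - entropy t] is [- ln (1 - t ^ 2)], so this is [ln_sum_le] at [t ^ 2],
    integrated termwise and divided by [2 * h]. *)
Lemma log_identric_le (h : R) (n : nat) : 0 < h < 1 ->
  sum_f_R0 (fun k => log_coeff k * (h ^ 2) ^ S k) n <= 1 - entropy h / (2 * h).
Proof.
  intros Hh.
  set (S' := fun t => sum_f_R0 (fun k => 2 * log_coeff k * t ^ S (2 * k + 2)) n).
  assert (H : 2 * 0 - entropy 0 - S' 0 <= 2 * h - entropy h - S' h).
  { apply (le_of_derive (fun t => 2 * t - entropy t - S' t)
      (fun t => - ln (1 - t ^ 2) - sum_f_R0 (fun k => / INR (S k) * (t ^ 2) ^ S k) n));
      [lra | | ].
    - intros t Ht. apply is_derive_sub.
      + unfold entropy. auto_derive; [lra | ].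
        replace (1 - t ^ 2) with ((1 + t) * (1 - t)) by ring.
        rewrite ln_mult by lra. unfold Rminus. field. lra.
      + evar_last.
        * apply (is_derive_sum_f (fun k t => 2 * log_coeff k * t ^ S (2 * k + 2))
           (fun k t => 2 * log_coeff k * (INR (S (2 * k + 2)) * t ^ (2 * k + 2)))).
          intros k. apply is_derive_monomial.
        * apply sum_eq. intros k _. unfold log_coeff.
          rewrite <- pow_mult. replace (2 * S k)%nat with (2 * k + 2)%nat by lia.
          rewrite !S_INR, plus_INR, mult_INR. simpl (INR 2).
          assert (Hk := pos_INR k). field. lra.
    - intros t Ht. assert (Ht2 : 0 <= t ^ 2 < 1) by nra.
      assert (Hl := ln_sum_le (t ^ 2) n Ht2). lra. }
  assert (S0 : S' 0 = 0).
  { unfold S'. rewrite (sum_eq _ (fun _ => 0)), sum_cte; [ring | ].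
    intros i _. simpl. ring. }
  assert (E0 : entropy 0 = 0).
  { unfold entropy. rewrite Rplus_0_r, Rminus_0_r, ln_1. ring. }
  assert (Sh : S' h = 2 * h * sum_f_R0 (fun k => log_coeff k * (h ^ 2) ^ S k) n).
  { unfold S'. rewrite scal_sum. apply sum_eq. intros k _.
    rewrite <- pow_mult. replace (2 * S k)%nat with (2 * k + 2)%nat by lia.
    cbn [pow]. ring. }
  rewrite S0, E0, Sh in H.
  apply (Rmult_le_reg_l (2 * h)); [lra | ].
  replace (2 * h * (1 - entropy h / (2 * h))) with (2 * h - entropy h) by (field; lra).
  lra.
Qed.

(** * Comparison of coefficients at [s = 1 + delta] *)

(** The sum of [e i / (4 * (k - i) + 6)] in the recursion for the coefficients of [exp Q], rounded
    termwise. The list starts with the latest index, hence the weights 6, 10, 14 and so on from its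
    head. *)
Fixpoint conv_floor (l : list Z) (w : Z) : Z :=
  match l with
  | nil => 0
  | x :: l' => x / w + conv_floor l' (w + 4)
  end%Z.

(** [exp_coeffs n] lists, from index [n] down to [0] and in units of [10^-9],
    coefficients rounded down; [dcoef_ceil] rounds [dcoef (399 / 10000)] up in
    the same unit. *)
Fixpoint exp_coeffs (n : nat) : list Z :=
  match n with
  | O => 1000000000 :: nil
  | S k => let l := exp_coeffs k in (conv_floor l 6 / Z.of_nat n) :: l
  end%Z.

Definition exp_coeff_floor (n : nat) : Z := hd 0%Z (exp_coeffs n).

(** The recursion of [dcoef] at [399 / 10000] with denominators cleared; [+ 1] turns the floor into
    an upper bound. *)
Definition dcoef_step (k : nat) (c : Z) : Z :=
  let j := Z.of_nat k in
  (c * (((2 * j + 1) * 10000 - 399) * ((2 * j + 2) * 10000 - 399))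
   / (100000000 * ((2 * j + 3) * (2 * j + 4))) + 1)%Z.

Fixpoint dcoef_ceil (n : nat) : Z :=
  match n with
  | O => 1000000000%Z
  | S k => dcoef_step k (dcoef_ceil k)
  end.

Fixpoint zsum (f : nat -> Z) (n : nat) : Z :=
  match n with
  | O => f O
  | S k => (zsum f k + f n)%Z
  end.

(** [0.00608] bounds [7 / 60 * delta * (1 - delta)], the loss in [even_gap_ge],
    times the bound [1.36] of [sum_exp_minor_le]. *)
Definition margin (s t : Z) : bool := (t + 6080000 <=? s)%Z.

Fixpoint margins (n : nat) : bool :=
  match n with
  | O => true
  | S k => margins k && margin (zsum exp_coeff_floor n) (zsum dcoef_ceil n)
  end.

(** One pass over all indices: the kernel would recompute [exp_coeffs] for each
    index if it evaluated [margins] directly. *)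
Fixpoint run (n : nat) : list Z * Z * Z * Z * bool :=
  match n with
  | O => (1000000000 :: nil, 1000000000, 1000000000, 1000000000, true)%Z
  | S k =>
    let '(l, s, t, d, ok) := run k in
    let e := (conv_floor l 6 / Z.of_nat n)%Z in
    let d' := dcoef_step k d in
    let s' := (s + e)%Z in
    let t' := (t + d')%Z in
    (e :: l, s', t', d', ok && margin s' t')
  end.

Lemma run_spec (n : nat) :
  run n = (exp_coeffs n, zsum exp_coeff_floor n, zsum dcoef_ceil n,
           dcoef_ceil n, margins n).
Proof.
  induction n as [ | n IH]; [reflexivity | ].
  cbn [run]. rewrite IH. reflexivity.
Qed.

(** A single evaluation supplies all numerical data; the next lemmas read off its components through
    [run_spec]. *)
Lemma run_40 :
  let '(_, s, t, d, ok) := run 40 in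
  (s, t, d, ok) = (1350615891, 1342168261, 246674, true)%Z.
Proof. vm_compute. reflexivity. Qed.

Lemma zsum_exp_40 : zsum exp_coeff_floor 40 = 1350615891%Z.
Proof. generalize run_40. rewrite run_spec. congruence. Qed.

Lemma zsum_dcoef_40 : zsum dcoef_ceil 40 = 1342168261%Z.
Proof. generalize run_40. rewrite run_spec. congruence. Qed.

Lemma dcoef_ceil_40 : dcoef_ceil 40 = 246674%Z.
Proof. generalize run_40. rewrite run_spec. congruence. Qed.

Lemma margins_40 : margins 40 = true.
Proof. generalize run_40. rewrite run_spec. congruence. Qed.

Lemma IZR_div_le (a b : Z) : (0 < b)%Z -> IZR (a / b) <= IZR a / IZR b.
Proof.
  intros Hb. assert (Hb' : 0 < IZR b) by (now apply IZR_lt).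
  apply Rle_div_r; [assumption | ]. rewrite <- mult_IZR. apply IZR_le.
  rewrite Z.mul_comm. now apply Z.mul_div_le.
Qed.

Lemma IZR_div_succ_ge (a b : Z) : (0 < b)%Z -> IZR a / IZR b <= IZR (a / b + 1).
Proof.
  intros Hb. assert (Hb' : 0 < IZR b) by (now apply IZR_lt).
  apply Rle_div_l; [assumption | ]. rewrite <- mult_IZR. apply IZR_le.
  assert (H := Z.mul_succ_div_gt a b Hb). lia.
Qed.

(** * From rounded integers to bounds on real coefficients *)

Definition unit_scale : R := 1000000000.

Definition exp_coeff (k : nat) : R := IZR (exp_coeff_floor k) / unit_scale.

Lemma conv_floor_nonneg (l : list Z) (w : Z) :
  (0 < w)%Z -> List.Forall (fun x => 0 <= x)%Z l -> (0 <= conv_floor l w)%Z.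
Proof.
  revert w. induction l as [ | x l IH]; intros w Hw Hl; [simpl; lia | ].
  inversion_clear Hl as [ | ? ? Hx Hl']. cbn [conv_floor].
  assert (0 <= x / w)%Z by (apply Z.div_pos; lia).
  specialize (IH (w + 4)%Z ltac:(lia) Hl'). lia.
Qed.

Lemma exp_coeffs_nonneg (n : nat) : List.Forall (fun x => 0 <= x)%Z (exp_coeffs n).
Proof.
  induction n as [ | n IH]; [repeat constructor; lia | ].
  cbn [exp_coeffs]. constructor; [ | exact IH].
  apply Z.div_pos; [ | lia]. apply conv_floor_nonneg; [lia | exact IH].
Qed.

Lemma exp_coeff_nonneg (k : nat) : 0 <= exp_coeff k.
Proof.
  unfold exp_coeff, exp_coeff_floor, unit_scale. apply Rdiv_le_0_compat; [ | lra].
  apply IZR_le. assert (H := exp_coeffs_nonneg k).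
  destruct (exp_coeffs k) as [ | x l]; [simpl; lia | ].
  now inversion_clear H.
Qed.

(** The offset [j] counts the list entries already passed, so that the induction can shift the
    weights. *)
Lemma conv_floor_le (k j : nat) :
  IZR (conv_floor (exp_coeffs k) (4 * Z.of_nat j + 6))
  <= sum_f_R0 (fun i => IZR (exp_coeff_floor i) / (4 * INR (k - i + j) + 6)) k.
Proof.
  assert (Hhd : forall m i, IZR (i / (4 * Z.of_nat m + 6)) <= IZR i / (4 * INR m + 6)).
  { intros m i. eapply Rle_trans; [apply IZR_div_le; lia | ].
    rewrite plus_IZR, mult_IZR, <- INR_IZR_INZ. apply Rle_refl. }
  revert j. induction k as [ | k IH]; intros j.
  - cbn [exp_coeffs conv_floor sum_f_R0]. rewrite Z.add_0_r. apply Hhd.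
  - cbn [exp_coeffs conv_floor]. rewrite plus_IZR, tech5, Rplus_comm.
    apply Rplus_le_compat.
    + replace (4 * Z.of_nat j + 6 + 4)%Z with (4 * Z.of_nat (S j) + 6)%Z by lia.
      eapply Rle_trans; [apply IH | ]. right. apply sum_eq. intros i Hi.
      replace (S k - i + j)%nat with (k - i + S j)%nat by lia. reflexivity.
    + replace (S k - S k + j)%nat with j by lia. apply Hhd.
Qed.

Lemma exp_coeff_rec (k : nat) :
  INR (S k) * exp_coeff (S k)
  <= sum_f_R0 (fun i => exp_coeff i * / (4 * INR (k - i) + 6)) k.
Proof.
  assert (Hk : 0 < INR (S k)) by (apply lt_0_INR; lia).
  apply Rle_trans with (IZR (conv_floor (exp_coeffs k) 6) * / unit_scale).
  - unfold exp_coeff, unit_scale.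
    change (exp_coeff_floor (S k)) with (conv_floor (exp_coeffs k) 6 / Z.of_nat (S k))%Z.
    assert (H := IZR_div_le (conv_floor (exp_coeffs k) 6) (Z.of_nat (S k)) ltac:(lia)).
    rewrite <- INR_IZR_INZ in H. apply Rle_div_r in H; [ | assumption]. lra.
  - rewrite Rmult_comm.
    assert (H := conv_floor_le k 0). simpl (4 * Z.of_nat 0 + 6)%Z in H.
    eapply Rle_trans; [apply Rmult_le_compat_l, H; unfold unit_scale; lra | ].
    rewrite scal_sum. right. apply sum_eq. intros i _.
    rewrite Nat.add_0_r. unfold exp_coeff, Rdiv. ring.
Qed.

(** Just below 0.04, as the threshold must be less than 1.04; since [lambda] increases in [s], a
    value close to 0.04 leaves the most room. *)
Definition delta : R := 399 / 10000.

Lemma dcoef_ceil_ge (k : nat) : dcoef delta k <= IZR (dcoef_ceil k) / unit_scale.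
Proof.
  induction k as [ | k IH]; [unfold unit_scale; simpl; lra | ].
  cbn [dcoef dcoef_ceil]. unfold dcoef_step.
  assert (Hk := pos_INR k). unfold unit_scale in *.
  set (c := dcoef_ceil k) in *.
  rewrite <- Rle_div_r by lra.
  eapply Rle_trans; [ | apply IZR_div_succ_ge;
    apply Z.mul_pos_pos; [lia | apply Z.mul_pos_pos; lia]].
  rewrite !mult_IZR, !minus_IZR, !mult_IZR, !plus_IZR, !mult_IZR, <- !INR_IZR_INZ.
  apply Rle_div_r in IH; [ | lra].
  unfold delta.
  match goal with |- ?A <= ?B =>
    replace A with (dcoef (399 / 10000) k * 1000000000
      * (((2 * INR k + 1 - 399 / 10000) * (2 * INR k + 2 - 399 / 10000))
         / ((2 * INR k + 3) * (2 * INR k + 4)))) by (field; lra);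
    replace B with (IZR c
      * (((2 * INR k + 1 - 399 / 10000) * (2 * INR k + 2 - 399 / 10000))
         / ((2 * INR k + 3) * (2 * INR k + 4)))) by (field; lra)
  end.
  apply Rmult_le_compat_r; [ | exact IH].
  apply Rlt_le, Rdiv_lt_0_compat; apply Rmult_lt_0_compat; lra.
Qed.

Lemma zsum_div (f : nat -> Z) (n : nat) :
  IZR (zsum f n) / unit_scale = sum_f_R0 (fun k => IZR (f k) / unit_scale) n.
Proof.
  induction n as [ | n IH]; [reflexivity | ].
  cbn [zsum]. rewrite plus_IZR, tech5, <- IH. unfold unit_scale. field.
Qed.

(** Index 0 is excluded: both partial sums equal 1 there. *)
Lemma margins_sum (n m : nat) : margins m = true -> (1 <= n <= m)%nat ->
  sum_f_R0 (dcoef delta) n + 608 / 100000 <= sum_f_R0 exp_coeff n.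
Proof.
  intros Hm Hn. induction m as [ | m IH]; [lia | ].
  cbn [margins] in Hm. apply andb_prop in Hm as [Hm Hm'].
  destruct (Nat.eq_dec n (S m)) as [-> | Hne]; [ | apply IH; [assumption | lia]].
  apply Z.leb_le, IZR_le in Hm'. rewrite plus_IZR in Hm'.
  apply Rle_trans with (IZR (zsum dcoef_ceil (S m)) / unit_scale + 608 / 100000).
  - apply Rplus_le_compat_r. rewrite zsum_div. apply sum_Rle.
    intros i _. apply dcoef_ceil_ge.
  - change (sum_f_R0 exp_coeff (S m)) with
      (sum_f_R0 (fun k => IZR (exp_coeff_floor k) / unit_scale) (S m)).
    rewrite <- zsum_div. unfold unit_scale. lra.
Qed.

(** * Coefficients beyond the index 40 *)

Definition total : R := 1350615891 / 1000000000.

(** Beyond the index 40, [exp_coeff] is replaced by an explicit lower bound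
    that still satisfies the recursion of [exp_sum_ge], because
    [total] is the sum of the first 41 coefficients. *)
Definition exp_minor (k : nat) : R :=
  if (k <=? 40)%nat then exp_coeff k else total * log_coeff (pred k).

Lemma exp_minor_le_40 (n : nat) : (n <= 40)%nat ->
  exp_minor n = exp_coeff n.
Proof. intros H. unfold exp_minor. apply Nat.leb_le in H. now rewrite H. Qed.

Lemma exp_minor_0 : exp_minor 0 = 1.
Proof.
  rewrite exp_minor_le_40 by lia. unfold exp_coeff, exp_coeff_floor, unit_scale.
  simpl. field.
Qed.

Lemma sum_exp_minor (n : nat) : (n <= 40)%nat ->
  sum_f_R0 exp_minor n = sum_f_R0 exp_coeff n.
Proof.
  intros H. apply sum_eq. intros i Hi. apply exp_minor_le_40. lia.
Qed.

Lemma exp_minor_gt_40 (n : nat) : (40 <= n)%nat ->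
  exp_minor (S n) = total * log_coeff n.
Proof.
  intros H. unfold exp_minor. destruct (Nat.leb_spec (S n) 40); [lia | reflexivity].
Qed.

Lemma log_coeff_pos (k : nat) : 0 < log_coeff k.
Proof.
  unfold log_coeff. assert (H := pos_INR k).
  apply Rinv_0_lt_compat, Rmult_lt_0_compat; lra.
Qed.

Lemma log_coeff_S (k : nat) : INR (S k) * log_coeff k = / (4 * INR k + 6).
Proof.
  unfold log_coeff. assert (H := pos_INR k). rewrite S_INR. field. lra.
Qed.

Lemma exp_minor_nonneg (k : nat) : 0 <= exp_minor k.
Proof.
  unfold exp_minor. destruct (k <=? 40)%nat; [apply exp_coeff_nonneg | ].
  assert (H := log_coeff_pos (pred k)). unfold total. lra.
Qed.

Lemma sum_exp_coeff_40 : sum_f_R0 exp_coeff 40 = total.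
Proof.
  change (sum_f_R0 (fun k => IZR (exp_coeff_floor k) / unit_scale) 40 = total).
  rewrite <- zsum_div, zsum_exp_40. reflexivity.
Qed.

Lemma sum_f_prefix_le (f : nat -> R) (m n : nat) :
  (forall k, 0 <= f k) -> (m <= n)%nat -> sum_f_R0 f m <= sum_f_R0 f n.
Proof.
  intros Hf Hmn. induction Hmn as [ | n Hmn IH]; [apply Rle_refl | ].
  rewrite tech5. specialize (Hf (S n)). lra.
Qed.

(** For [k >= 40], the terms with [i > 40] are discarded and the other weights lowered to
    [1 / (4 * k + 6)]; what remains is [total / (4 * k + 6)], which equals the left-hand side. *)
Lemma exp_minor_rec (k : nat) :
  INR (S k) * exp_minor (S k)
  <= sum_f_R0 (fun i => exp_minor i * (INR (S (k - i)) * log_coeff (k - i))) k.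
Proof.
  rewrite (sum_eq _ (fun i => exp_minor i * / (4 * INR (k - i) + 6))).
  2: { intros i _. now rewrite log_coeff_S. }
  assert (Hpos : forall i, 0 < / (4 * INR i + 6)).
  { intros i. apply Rinv_0_lt_compat. assert (H := pos_INR i). lra. }
  destruct (Nat.lt_ge_cases k 40) as [Hk | Hk].
  - rewrite exp_minor_le_40 by lia.
    eapply Rle_trans; [apply exp_coeff_rec | ]. right. apply sum_eq.
    intros i Hi. rewrite exp_minor_le_40 by lia. reflexivity.
  - rewrite exp_minor_gt_40 by assumption.
    replace (INR (S k) * (total * log_coeff k))
      with (/ (4 * INR k + 6) * total) by (rewrite <- log_coeff_S; ring).
    rewrite <- sum_exp_coeff_40, <- (sum_exp_minor 40), scal_sum by lia.
    eapply Rle_trans; [apply (sum_f_prefix_le _ 40 k); [ | exact Hk] | ].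
    + intros i. apply Rmult_le_pos; [apply exp_minor_nonneg | apply Rlt_le, Hpos].
    + apply sum_Rle. intros i Hi.
      apply Rmult_le_compat_l; [apply exp_minor_nonneg | ].
      apply Rinv_le_contravar; [assert (H := pos_INR (k - i)); lra | ].
      assert (H : INR (k - i) <= INR k) by (apply le_INR; lia). lra.
Qed.

(** The ratio [dcoef delta (S k) / log_coeff k] decreases only once [k] exceeds
    about [1 / delta], which forces a cutoff of this size. *)
Lemma dcoef_tail (k : nat) : (40 <= k)%nat ->
  dcoef delta (S k) <= 16 / 10 * log_coeff k.
Proof.
  intros Hk.
  enough (H : forall j, (40 <= j)%nat -> dcoef delta j <= 16 / 10 * log_coeff (pred j)).
  { apply (H (S k)). lia. }
  intros j Hj. induction Hj as [ | j Hj IH].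
  (* At [j = 40] the value 0.000246674 is compared with [1.6 / (80 * 81)], about 0.000246914; this
     fixes the factor [16 / 10]. *)
  - eapply Rle_trans; [apply dcoef_ceil_ge | ].
    rewrite dcoef_ceil_40. unfold log_coeff, unit_scale. simpl. lra.
  - cbn [dcoef pred]. replace j with (S (pred j)) in * by lia.
    set (i := pred j) in *. cbn [pred] in IH.
    assert (Hi : 39 <= INR i).
    { replace 39 with (INR 39) by (simpl; ring). apply le_INR. lia. }
    rewrite !S_INR. unfold log_coeff in *. rewrite S_INR.
    set (n := INR i) in *.
    apply Rle_trans with (16 / 10 * / ((2 * n + 2) * (2 * n + 3))
      * (((2 * (n + 1) + 1 - delta) * (2 * (n + 1) + 2 - delta))
         / ((2 * (n + 1) + 3) * (2 * (n + 1) + 4)))).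
    + unfold Rdiv at 1. rewrite Rmult_assoc.
      apply Rmult_le_compat_r; [ | exact IH].
      unfold delta. apply Rlt_le, Rdiv_lt_0_compat; apply Rmult_lt_0_compat; lra.
    + unfold delta.
      apply (Rmult_le_reg_r ((2 * n + 2) * (2 * n + 3) * ((2 * n + 5) * (2 * n + 6) * (2 * n + 4)))).
      { repeat apply Rmult_lt_0_compat; lra. }
      match goal with |- ?A <= ?B =>
        replace A with (16 / 10 * ((2 * n + 3 - 399 / 10000) * (2 * n + 4 - 399 / 10000) * (2 * n + 4)))
          by (field; lra);
        replace B with (16 / 10 * ((2 * n + 2) * (2 * n + 3) * (2 * n + 6)))
          by (field; lra) end.
      nra.
Qed.

(** Lowering the factor [2 * k + 2] to [2 * k + 1] makes the term telescope. *)
Lemma log_coeff_le (k : nat) :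
  log_coeff k <= / (4 * INR k + 2) - / (4 * INR (S k) + 2).
Proof.
  unfold log_coeff. rewrite S_INR. assert (H := pos_INR k).
  set (n := INR k) in *. clearbody n.
  replace (/ (4 * n + 2) - / (4 * (n + 1) + 2)) with (/ ((2 * n + 1) * (2 * n + 3)))
    by (field; lra).
  apply Rinv_le_contravar; [apply Rmult_lt_0_compat; lra | nra].
Qed.

Lemma sum_exp_minor_le (n : nat) : sum_f_R0 exp_minor n <= 136 / 100.
Proof.
  destruct (Nat.le_ge_cases n 40) as [Hn | Hn].
  - eapply Rle_trans; [apply (sum_f_prefix_le _ n 40 exp_minor_nonneg Hn) | ].
    rewrite sum_exp_minor, sum_exp_coeff_40 by lia. unfold total. lra.
  (* Here [162 = 4 * 40 + 2]; the telescoped tail keeps the sum below [total * (1 + 1 / 162)], about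
     1.35896. *)
  - enough (H : sum_f_R0 exp_minor n <= total + total * (/ 162 - / (4 * INR n + 2))).
    { eapply Rle_trans; [exact H | ].
      assert (0 < / (4 * INR n + 2))
        by (apply Rinv_0_lt_compat; assert (Hp := pos_INR n); lra).
      unfold total. lra. }
    induction Hn as [ | n Hn IH].
    + rewrite sum_exp_minor, sum_exp_coeff_40 by lia. simpl. unfold total. lra.
    + rewrite tech5, exp_minor_gt_40 by assumption.
      assert (H := log_coeff_le n). unfold total in *. lra.
Qed.

Lemma sum_exp_minor_ge (n : nat) : (1 <= n)%nat ->
  sum_f_R0 (dcoef delta) n + 608 / 100000 <= sum_f_R0 exp_minor n.
Proof.
  intros Hn. destruct (Nat.le_ge_cases n 40) as [Hn' | Hn'].
  { rewrite sum_exp_minor by assumption.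
    apply (margins_sum n 40 margins_40). lia. }
  clear Hn.
  (* The added reserve pays for the tail: each later step loses at most
     [(16 / 10 - total) * log_coeff n], which the telescoping difference covers. *)
  enough (H : sum_f_R0 (dcoef delta) n + 608 / 100000
    + (16 / 10 - total) * / (4 * INR n + 2) <= sum_f_R0 exp_minor n).
  { assert (0 < / (4 * INR n + 2))
      by (apply Rinv_0_lt_compat; assert (Hp := pos_INR n); lra).
    unfold total in *. lra. }
  induction Hn' as [ | n Hn IH].
  - rewrite sum_exp_minor, sum_exp_coeff_40 by lia.
    assert (H : sum_f_R0 (dcoef delta) 40 <= 1342168261 / unit_scale).
    { rewrite <- zsum_dcoef_40, zsum_div. apply sum_Rle. intros i _.
      apply dcoef_ceil_ge. }
    unfold unit_scale in H. unfold total. simpl (INR 40). lra.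
  - rewrite !tech5, exp_minor_gt_40 by assumption.
    assert (H := log_coeff_le n). assert (Hd := dcoef_tail n Hn).
    unfold total in *. lra.
Qed.

(** With [D] and [F] the truncated series of [dcoef] and [exp_minor], one has
    [D + 0.00608 * x <= F <= exp Q]. As [F <= 1.36], the reserve exceeds [a * x * F], so
    [D <= F * (1 - a * x)]. *)
Lemma even_gap_exp_ge (h : R) : 0 < h < 1 ->
  even_gap (1 + delta) h * / ((1 + delta) * delta * h ^ 2)
  <= exp (1 - entropy h / (2 * h)) * (1 - 7 / 60 * delta * (1 - delta) * h ^ 2).
Proof.
  intros Hh.
  assert (Hx : 0 < h ^ 2 < 1) by nra.
  assert (Hden : 0 < (1 + delta) * delta * h ^ 2) by (unfold delta; lra).
  set (a := 7 / 60 * delta * (1 - delta)).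
  assert (Ha : 0 < a /\ a * (136 / 100) <= 608 / 100000) by (unfold a, delta; lra).
  set (W := exp (1 - entropy h / (2 * h)) * (1 - a * h ^ 2)).
  (* The truncation error is at most [h ^ n] for every [n], so in the limit the difference is not
     positive. *)
  assert (Hn : forall n, even_gap (1 + delta) h * / ((1 + delta) * delta * h ^ 2)
                - W <= h ^ n).
  { intros n.
    set (x := h ^ 2) in *.
    set (F := sum_f_R0 (fun k => exp_minor k * x ^ k) (S n)).
    set (D := sum_f_R0 (fun k => dcoef delta k * x ^ k) (S n)).
    assert (HF : F <= exp (1 - entropy h / (2 * h))).
    { eapply Rle_trans; [apply (exp_sum_ge log_coeff) | ].
      - lra.
      - intros k. apply Rlt_le, log_coeff_pos.
      - apply exp_minor_nonneg.
      - rewrite exp_minor_0. lra.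
      - apply exp_minor_rec.
      - destruct (log_identric_le h n Hh) as [H | H].
        + left. apply exp_increasing. exact H.
        + right. f_equal. exact H. }
    assert (HF1 : F <= 136 / 100).
    { eapply Rle_trans; [ | apply (sum_exp_minor_le (S n))].
      apply sum_Rle. intros k _.
      rewrite <- (Rmult_1_r (exp_minor k)) at 2.
      apply Rmult_le_compat_l; [apply exp_minor_nonneg | ].
      rewrite <- (pow1 k). apply pow_incr. lra. }
    assert (HD : even_gap (1 + delta) h * / ((1 + delta) * delta * x)
      <= D + h ^ (2 * S n + 1)).
    { apply (Rle_div_l _ _ _ Hden).
      rewrite Rmult_comm. apply even_gap_le; [unfold delta; lra | exact Hh]. }
    assert (Hab : D + 608 / 100000 * x <= F).
    (* The reserve sits at degree 1; the partial sum at index 0 is exactly 0, and the later ones are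
       covered by [sum_exp_minor_ge]. *)
    { assert (H : 0 <= sum_f_R0 (fun k => (exp_minor k - dcoef delta k
        - (if Nat.eqb k 1 then 608 / 100000 else 0)) * x ^ k) (S n)).
      { apply abel_nonneg; [lra | ]. intros k _.
        rewrite !minus_sum.
        destruct k as [ | k].
        - change (0 <= exp_minor 0 - 1 - 0). rewrite exp_minor_0. lra.
        - assert (E : sum_f_R0 (fun i => if Nat.eqb i 1 then 608 / 100000 else 0) (S k)
            = 608 / 100000).
          { induction k as [ | k IH]; [simpl; ring | ].
            rewrite tech5, IH. simpl. ring. }
          rewrite E. assert (H := sum_exp_minor_ge (S k) ltac:(lia)). lra. }
      assert (E : forall m, sum_f_R0 (fun k => (if Nat.eqb k 1 then 608 / 100000 else 0) * x ^ k) (S m)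
        = 608 / 100000 * x).
      { induction m as [ | m IH]; [simpl; ring | ].
        rewrite tech5, IH. simpl. ring. }
      specialize (E n). unfold F, D.
      rewrite (sum_eq _ (fun k => exp_minor k * x ^ k - dcoef delta k * x ^ k
        - (if Nat.eqb k 1 then 608 / 100000 else 0) * x ^ k)) in H
        by (intros; ring).
      rewrite !minus_sum, E in H. lra. }
    assert (Hpow : h ^ (2 * S n + 1) <= h ^ n).
    { replace (2 * S n + 1)%nat with (n + (n + 3))%nat by lia.
      rewrite pow_add.
      assert (0 < h ^ n) by (apply pow_lt; lra).
      assert (h ^ (n + 3) <= 1) by (rewrite <- (pow1 (n + 3)); apply pow_incr; lra).
      nra. }
    assert (HW : F * (1 - a * x) <= W).
    { apply Rmult_le_compat_r; [ | exact HF].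
      assert (a * x <= a * 1) by (apply Rmult_le_compat_l; lra). lra. }
    assert (F * (a * x) <= 608 / 100000 * x).
    { rewrite <- Rmult_assoc. apply Rmult_le_compat_r; [lra | ].
      assert (F * a <= 136 / 100 * a) by (apply Rmult_le_compat_r; lra). lra. }
    lra. }
  apply Rnot_lt_le. intros Hlt.
  destruct (pow_lt_1_zero h) with
    (y := even_gap (1 + delta) h * / ((1 + delta) * delta * h ^ 2) - W) as [N HN].
  - rewrite Rabs_pos_eq; lra.
  - lra.
  - specialize (HN N (le_n N)). specialize (Hn N).
    assert (0 < h ^ N) by (apply pow_lt; lra).
    rewrite Rabs_pos_eq in HN; lra.
Qed.

(** * The two numerical endpoints and the threshold *)

Lemma identric_exp (a b : R) : 0 < a -> 0 < b -> a <> b ->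
  identric a b = exp ((b * ln b - a * ln a) / (b - a) - 1).
Proof.
  intros Ha Hb Hab. unfold identric.
  destruct (Req_EM_T a b) as [H | _]; [easy | ].
  replace (Rpower b b / Rpower a a) with (exp (b * ln b - a * ln a)).
  2: { unfold Rpower, Rminus, Rdiv. now rewrite exp_plus, exp_Ropp. }
  unfold Rpower. rewrite ln_exp.
  replace (1 / exp 1) with (exp (- (1))) by (rewrite exp_Ropp; field; apply Rgt_not_eq, exp_pos).
  rewrite <- exp_plus. f_equal. field. lra.
Qed.

Lemma identric_sym (a b : R) : 0 < a -> 0 < b -> identric a b = identric b a.
Proof.
  intros Ha Hb. destruct (Req_dec a b) as [-> | Hab]; [reflexivity | ].
  rewrite !identric_exp by auto. f_equal. field. lra.
Qed.

Lemma mean_coordinates (a b : R) : 0 < a -> a < b ->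
  exists m h, 0 < m /\ 0 < h < 1 /\ a = m * (1 - h) /\ b = m * (1 + h).
Proof.
  intros Ha Hab. exists ((a + b) / 2), ((b - a) / (a + b)).
  split; [lra | ]. split; [split | split; field; lra].
  - apply Rdiv_lt_0_compat; lra.
  - apply Rlt_div_l; lra.
Qed.

Lemma identric_scaled (m h : R) : 0 < m -> 0 < h < 1 ->
  identric (m * (1 - h)) (m * (1 + h)) = m * exp (entropy h / (2 * h) - 1).
Proof.
  intros Hm Hh.
  rewrite identric_exp by nra.
  rewrite <- (exp_ln m Hm) at 7. rewrite <- exp_plus. f_equal.
  rewrite !ln_mult by lra. unfold entropy. field.
  split; [lra | ]. nra.
Qed.

Lemma even_gap_pos (d h : R) : 0 < d -> 0 < h < 1 -> 0 < even_gap (1 + d) h.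
Proof.
  intros Hd Hh.
  assert (H := Phi_pos (1 + d) (1 - h) (1 + h) ltac:(lra) ltac:(lra)).
  rewrite Phi_generic in H by lra.
  replace ((1 - h + (1 + h)) / 2) with 1 in H by field.
  rewrite Rpower_base_1 in H.
  replace (even_gap (1 + d) h) with
    ((Rpower (1 - h) (1 + d) + Rpower (1 + h) (1 + d) - 2 * 1)
     / ((1 + d) * (1 + d - 1)) * ((1 + d) * d)).
  - apply Rmult_lt_0_compat; nra.
  - unfold even_gap. field. lra.
Qed.

Lemma lambda_scaled (d m h : R) : 0 < d -> 0 < m -> 0 < h < 1 ->
  lambda (1 + d) (m * (1 - h)) (m * (1 + h))
  = m * (d / (2 + d) * (even_gap (2 + d) h / even_gap (1 + d) h)).
Proof.
  intros Hd Hm Hh.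
  assert (Hp := even_gap_pos d h Hd Hh).
  unfold lambda.
  destruct (Req_EM_T (m * (1 - h)) (m * (1 + h))) as [H | _]; [nra | ].
  cbv zeta.
  replace ((m * (1 - h) + m * (1 + h)) / 2) with m by field.
  destruct (Req_EM_T (1 + d) (-1)); [lra | ].
  destruct (Req_EM_T (1 + d) 0); [lra | ].
  destruct (Req_EM_T (1 + d) 1); [lra | ].
  replace (1 + d + 1) with (2 + d) by ring.
  rewrite <- !Rpower_mult_distr by lra.
  replace (Rpower m (2 + d)) with (Rpower m (1 + d) * m).
  2: { rewrite <- Rpower_plus_1 by assumption. f_equal. ring. }
  assert (HM := Rpower_pos m (1 + d)).
  unfold even_gap in *. field. repeat split; try lra.
  intros H. assert (0 < Rpower m (1 + d) * (Rpower (1 + h) (1 + d) + Rpower (1 - h) (1 + d) - 2))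
    by (apply Rmult_lt_0_compat; assumption).
  lra.
Qed.

(** The upper bound for the denominator and the lower bound for the numerator share the factor [c],
    which cancels and leaves [exp (E - 1)]. *)
Lemma identric_le_lambda_delta (a b : R) : 0 < a -> a < b ->
  identric a b <= lambda (1 + delta) a b.
Proof.
  intros Ha Hab.
  destruct (mean_coordinates a b Ha Hab) as (m & h & Hm & Hh & -> & ->).
  assert (Hd : 0 < delta < 1) by (unfold delta; lra).
  rewrite identric_scaled, lambda_scaled by lra.
  apply Rmult_le_compat_l; [lra | ].
  assert (HG := even_gap_pos delta h (proj1 Hd) Hh).
  assert (H1 := even_gap_exp_ge h Hh). assert (H2 := even_gap_ge delta h Hd Hh).
  set (c := 1 - 7 / 60 * delta * (1 - delta) * h ^ 2) in *.
  set (G1 := even_gap (1 + delta) h) in *. set (G2 := even_gap (2 + delta) h) in *.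
  set (E := entropy h / (2 * h)) in *.
  assert (Hh2 : 0 < h ^ 2) by (apply pow_lt; lra).
  assert (HP : 0 < (1 + delta) * delta * h ^ 2).
  { apply Rmult_lt_0_compat; [apply Rmult_lt_0_compat | ]; lra. }
  apply (Rle_div_l _ _ _ HP) in H1.
  assert (HE := exp_pos (E - 1)).
  assert (HEE : exp (E - 1) * exp (1 - E) = 1).
  { rewrite <- exp_plus, <- exp_0. f_equal. ring. }
  assert (H3 : exp (E - 1) * G1 <= c * ((1 + delta) * delta * h ^ 2)).
  { apply (Rmult_le_compat_l (exp (E - 1))) in H1; [ | lra].
    replace (exp (E - 1) * (exp (1 - E) * c * ((1 + delta) * delta * h ^ 2)))
      with (exp (E - 1) * exp (1 - E) * (c * ((1 + delta) * delta * h ^ 2))) in H1 by ring.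
    rewrite HEE in H1. lra. }
  replace (delta / (2 + delta) * (G2 / G1)) with (delta / (2 + delta) * G2 / G1)
    by (field; lra).
  apply (Rle_div_r _ _ _ HG).
  eapply Rle_trans; [exact H3 | ].
  replace (c * ((1 + delta) * delta * h ^ 2))
    with (delta / (2 + delta) * ((2 + delta) * (1 + delta) * h ^ 2 * c)) by (field; lra).
  apply Rmult_le_compat_l; [ | exact H2].
  apply Rlt_le, Rdiv_lt_0_compat; lra.
Qed.

Lemma ln_ge_pade (u : R) : 0 <= u -> 2 * u / (2 + u) <= ln (1 + u).
Proof.
  intros Hu.
  enough (H : ln (1 + 0) - 2 * 0 / (2 + 0) <= ln (1 + u) - 2 * u / (2 + u)).
  { rewrite Rplus_0_r, ln_1 in H. lra. }
  apply (le_of_derive (fun t => ln (1 + t) - 2 * t / (2 + t))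
    (fun t => t ^ 2 / ((1 + t) * (2 + t) ^ 2))); [exact Hu | | ].
  - intros t Ht. auto_derive; [lra | field; lra].
  - intros t Ht. apply Rdiv_le_0_compat; [apply pow2_ge_0 | ].
    apply Rmult_lt_0_compat; [lra | apply pow_lt; lra].
Qed.

(** This is [ln_ge_pade] at [u = 2 * y / (2 - y)], the substitution that turns its left-hand side
    into [y]. *)
Lemma exp_neg_ge_pade (y : R) : 0 <= y < 2 -> (2 - y) / (2 + y) <= exp (- y).
Proof.
  intros Hy.
  assert (Hu : 0 <= 2 * y / (2 - y)) by (apply Rdiv_le_0_compat; lra).
  assert (H := ln_ge_pade _ Hu).
  replace (2 * (2 * y / (2 - y)) / (2 + 2 * y / (2 - y))) with y in H by (field; lra).
  replace (1 + 2 * y / (2 - y)) with ((2 + y) / (2 - y)) in H by (field; lra).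
  assert (Hp : 0 < (2 + y) / (2 - y)) by (apply Rdiv_lt_0_compat; lra).
  replace ((2 - y) / (2 + y)) with (exp (- ln ((2 + y) / (2 - y)))).
  - destruct H as [H | H]; [left; apply exp_increasing; lra | right; f_equal; lra].
  - rewrite exp_Ropp, exp_ln by assumption. field. lra.
Qed.

(** Reduces numerical bounds on an [n]-th root to comparisons of [n]-th powers of rationals. *)
Lemma Rpower_root_bounds (x lo hi : R) (n : nat) :
  (0 < n)%nat -> 0 < x -> 0 <= hi -> lo ^ n < x < hi ^ n ->
  lo <= Rpower x (/ INR n) <= hi.
Proof.
  intros Hn Hx Hhi Hb.
  assert (Hn' : INR n <> 0) by (apply not_0_INR; lia).
  assert (Hr := Rpower_pos x (/ INR n)).
  assert (E : Rpower x (/ INR n) ^ n = x).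
  { rewrite <- Rpower_pow by assumption. rewrite Rpower_mult, Rinv_l, Rpower_1; auto. }
  set (r := Rpower x (/ INR n)) in *.
  split; apply Rnot_lt_le; intros H.
  - assert (r ^ n <= lo ^ n) by (apply pow_incr; lra). lra.
  - assert (hi ^ n <= r ^ n) by (apply pow_incr; lra). lra.
Qed.

(** The exponent 1.03125 exceeds 1.03 and brings in only 32nd roots. The two sides are separated by
    [0.7365 < exp (- 0.305)]. *)
Lemma lambda_lt_identric_low :
  lambda (1 + / 32) (1 / 1000) (1999 / 1000) < identric (1 / 1000) (1999 / 1000).
Proof.
  set (h := 999 / 1000).
  replace (1 / 1000) with (1 * (1 - h)) by (unfold h; field).
  replace (1999 / 1000) with (1 * (1 + h)) by (unfold h; field).
  rewrite lambda_scaled, identric_scaled by (unfold h; lra).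
  rewrite !Rmult_1_l.
  assert (HA : 8 / 10 <= Rpower (1 - h) (/ 32) <= 81 / 100).
  { replace 32 with (INR 32) by (simpl; ring).
    apply Rpower_root_bounds; unfold h; [lia | lra | lra | lra]. }
  assert (HB : 102188 / 100000 <= Rpower (1 + h) (/ 32) <= 102189 / 100000).
  { replace 32 with (INR 32) by (simpl; ring).
    apply Rpower_root_bounds; unfold h; [lia | lra | lra | lra]. }
  (* From [ln u <= u - 1] at [u = 0.81], an upper bound for the 32nd root of [1 - h]. *)
  assert (HlnA : 32 * (19 / 100) <= - ln (1 - h)).
  { assert (H := ln_Rpower (1 - h) (/ 32)).
    assert (Hl := ln_le (Rpower (1 - h) (/ 32)) (81 / 100) (Rpower_pos _ _) (proj2 HA)).
    assert (Hu := exp_ineq1_le (ln (81 / 100))). rewrite exp_ln in Hu by lra. lra. }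
  assert (HlnB : 32 * (2 * (2188 / 100000) / (2 + 2188 / 100000)) <= ln (1 + h)).
  { assert (H := ln_Rpower (1 + h) (/ 32)).
    assert (Hl := ln_le (1 + 2188 / 100000) (Rpower (1 + h) (/ 32)) ltac:(lra) ltac:(lra)).
    assert (Hu := ln_ge_pade (2188 / 100000) ltac:(lra)). lra. }
  set (A := Rpower (1 - h) (/ 32)) in *. set (B := Rpower (1 + h) (/ 32)) in *.
  assert (G1 : even_gap (1 + / 32) h = B * (1 + h) + A * (1 - h) - 2).
  { unfold even_gap. rewrite !(Rplus_comm 1 (/ 32)), !Rpower_plus_1 by (unfold h; lra).
    reflexivity. }
  assert (G2 : even_gap (2 + / 32) h = B * (1 + h) ^ 2 + A * (1 - h) ^ 2 - 2).
  { unfold even_gap. replace (2 + / 32) with (/ 32 + 1 + 1) by ring.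
    rewrite !Rpower_plus_1 by (unfold h; lra). fold A B. ring. }
  rewrite G1, G2.
  assert (Hlam : / 32 / (2 + / 32) * ((B * (1 + h) ^ 2 + A * (1 - h) ^ 2 - 2)
      / (B * (1 + h) + A * (1 - h) - 2)) < 7365 / 10000).
  { unfold h in *.
    set (N := B * (1 + 999 / 1000) ^ 2 + A * (1 - 999 / 1000) ^ 2 - 2).
    set (D := B * (1 + 999 / 1000) + A * (1 - 999 / 1000) - 2).
    assert (HD : 0 < D) by (unfold D; lra).
    replace (/ 32 / (2 + / 32) * (N / D)) with (N / 65 / D) by (field; lra).
    apply (Rlt_div_l _ _ _ HD). unfold N, D. lra. }
  apply Rlt_trans with (1 := Hlam).
  (* A quarter of 0.305: the rational bound for [exp (- z)] is sharp enough only after this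
     splitting into four factors. *)
  set (z := 305 / 4000).
  assert (Hz := exp_neg_ge_pade z ltac:(unfold z; lra)).
  apply Rlt_le_trans with (((2 - z) / (2 + z)) ^ 4); [unfold z; lra | ].
  apply Rle_trans with (exp (- z) ^ 4).
  { apply pow_incr. split; [ | exact Hz]. unfold z; lra. }
  replace (exp (- z) ^ 4) with (exp (- (4 * z))).
  2: { replace (- (4 * z)) with (- z + - z + - z + - z) by ring.
       rewrite !exp_plus. ring. }
  apply Rlt_le, exp_increasing.
  enough (1 - 4 * z < entropy h / (2 * h)) by lra.
  apply Rlt_div_r; [unfold h; lra | ].
  unfold entropy, z. unfold h in *. lra.
Qed.

(** A strict failure of the lower bound at [s] persists slightly to the right, so the bound passes
    to the infimum of the [s] where it holds. *)
Lemma lambda_right_continuous (s a b c : R) : 1 < s -> 0 < a -> a < b ->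
  lambda s a b < c -> exists t, s < t /\ lambda t a b < c.
Proof.
  intros Hs Ha Hab Hc.
  (* The generic branch with [Rpower] unfolded, in a form that [auto_derive] can differentiate in
     [u]. *)
  set (g := fun u => (u - 1) / (u + 1) *
    ((exp ((u + 1) * ln a) + exp ((u + 1) * ln b) - 2 * exp ((u + 1) * ln ((a + b) / 2))) /
     (exp (u * ln a) + exp (u * ln b) - 2 * exp (u * ln ((a + b) / 2))))).
  assert (Hg : forall u, 1 < u -> lambda u a b = g u).
  { intros u Hu. unfold lambda.
    destruct (Req_EM_T a b); [lra | ]. cbv zeta.
    destruct (Req_EM_T u (-1)); [lra | ].
    destruct (Req_EM_T u 0); [lra | ].
    destruct (Req_EM_T u 1); [lra | ]. reflexivity. }
  assert (HD : exp (s * ln a) + exp (s * ln b) - 2 * exp (s * ln ((a + b) / 2)) <> 0).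
  { intros H. assert (HP := Phi_pos s a b Ha Hab).
    rewrite Phi_generic in HP by lra. unfold Rpower in HP. rewrite H in HP.
    unfold Rdiv in HP. rewrite Rmult_0_l in HP. lra. }
  assert (Hcont : continuity_pt g s).
  { apply continuity_pt_filterlim.
    apply (ex_derive_continuous g s).
    unfold g. auto_derive. repeat split; [lra | exact HD]. }
  rewrite Hg in Hc by assumption.
  destruct (Hcont (c - g s) ltac:(lra)) as [alp [Halp H]].
  exists (s + alp / 2). split; [lra | ].
  rewrite Hg by lra.
  specialize (H (s + alp / 2)). simpl in H. unfold Rdist in H.
  assert (Hlt : Rabs (g (s + alp / 2) - g s) < c - g s).
  { apply H. split.
    - split; [exact I | lra].
    - rewrite Rabs_pos_eq; lra. }
  apply Rabs_def2 in Hlt. lra.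
Qed.

Definition identric_bound (s : R) : Prop :=
  forall a b : R, 0 < a -> 0 < b -> identric a b <= lambda s a b.

Lemma identric_bound_intro (s : R) :
  (forall a b, 0 < a -> a < b -> identric a b <= lambda s a b) ->
  identric_bound s.
Proof.
  intros H a b Ha Hb. destruct (Rtotal_order a b) as [Hab | [-> | Hab]].
  - now apply H.
  - unfold identric, lambda. destruct (Req_EM_T b b); [apply Rle_refl | easy].
  - rewrite identric_sym, lambda_sym by assumption. now apply H.
Qed.

Lemma identric_bound_mono (s t : R) :
  s <= t -> identric_bound s -> identric_bound t.
Proof.
  intros [Hst | <-] Hs; [ | assumption].
  apply identric_bound_intro. intros a b Ha Hab.
  apply Rle_trans with (lambda s a b); [apply Hs; lra | ].
  now apply Rlt_le, lambda_lt.
Qed.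

Lemma lambda_le_amean (s a b : R) :
  s <= 2 -> 0 < a -> 0 < b -> lambda s a b <= amean a b.
Proof.
  intros Hs.
  assert (H : forall a b, 0 < a -> a < b -> lambda s a b <= amean a b).
  { clear a b. intros a b Ha Hab. rewrite <- lambda_2 by assumption.
    destruct Hs as [Hs | ->]; [ | apply Rle_refl].
    now apply Rlt_le, lambda_lt. }
  intros Ha Hb. destruct (Rtotal_order a b) as [Hab | [-> | Hab]].
  - now apply H.
  - unfold lambda, amean. destruct (Req_EM_T b b); [lra | easy].
  - rewrite lambda_sym. unfold amean. rewrite Rplus_comm. now apply H.
Qed.

Theorem theorem3 :
  exists s1 : R,
    103 / 100 < s1 < 104 / 100 /\
    (forall s : R, s1 <= s <= 2 ->
       forall a b : R, 0 < a -> 0 < b ->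
         identric a b <= lambda s a b /\ lambda s a b <= amean a b) /\
    (forall s : R,
       (forall a b : R, 0 < a -> 0 < b -> identric a b <= lambda s a b)
       <-> s1 <= s) /\
    (forall s : R,
       (forall a b : R, 0 < a -> 0 < b -> lambda s a b <= amean a b)
       <-> s <= 2).
Proof.
  assert (Hhigh : identric_bound (1 + delta)).
  { apply identric_bound_intro. exact identric_le_lambda_delta. }
  assert (Hlow : ~ identric_bound (1 + / 32)).
  { intros H. specialize (H (1 / 1000) (1999 / 1000) ltac:(lra) ltac:(lra)).
    assert (H' := lambda_lt_identric_low). lra. }
  (* The threshold is the supremum of the exponents for which the lower bound fails. *)
  destruct (completeness (fun s => ~ identric_bound s)) as [s1 [Hub Hlub]].
  { exists (1 + delta). intros s Hs. apply Rnot_lt_le. intros Hlt. apply Hs.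
    apply (identric_bound_mono (1 + delta)); [lra | assumption]. }
  { now exists (1 + / 32). }
  assert (Hs1_low : 1 + / 32 <= s1) by now apply Hub.
  assert (Hs1_high : s1 <= 1 + delta).
  { apply Hlub. intros s Hs. apply Rnot_lt_le. intros Hlt. apply Hs.
    apply (identric_bound_mono (1 + delta)); [lra | assumption]. }
  assert (Habove : forall s, s1 < s -> identric_bound s).
  { intros s Hs. apply NNPP. intros H. apply Hub in H. lra. }
  assert (Hat : identric_bound s1).
  { apply identric_bound_intro. intros a b Ha Hab. apply Rnot_lt_le. intros Hlt.
    destruct (lambda_right_continuous s1 a b _ ltac:(lra) Ha Hab Hlt) as [t [Ht Hlt']].
    specialize (Habove t Ht a b Ha ltac:(lra)). lra. }
  assert (Hiff : forall s, identric_bound s <-> s1 <= s).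
  { intros s. split.
    - intros Hs. apply Hlub. intros t Ht. apply Rnot_lt_le. intros Hlt. apply Ht.
      apply (identric_bound_mono s); [lra | assumption].
    - intros Hs. now apply (identric_bound_mono s1). }
  exists s1. unfold delta in *. split; [lra | ]. split; [ | split].
  - intros s Hs a b Ha Hb. split.
    + now apply Hiff.
    + now apply lambda_le_amean.
  - exact Hiff.
  - intros s. split.
    + intros H. apply Rnot_lt_le. intros Hlt.
      (* Any two distinct points would do: [lambda] at 2 is already the arithmetic mean and
         increases strictly beyond. *)
      specialize (H 1 2 ltac:(lra) ltac:(lra)).
      rewrite <- lambda_2 in H by lra.
      assert (H' := lambda_lt 2 s 1 2 ltac:(lra) ltac:(lra) Hlt). lra.
    + intros Hs a b Ha Hb. now apply lambda_le_amean.
Qed.
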